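(* Let $\hat G$ be a Hausdorff topological group, $G$ a topological subgroup of $\hat G$, $Q$ a locally compact Hausdorff group, and $1\to G\to\hat G\xrightarrow{q}Q\to1$ an exact sequence of topological groups (in particular $q$ is a continuous homomorphism). Let $\Lambda$ be a discrete subgroup of $Q$ with a homomorphism $s_1\colon\Lambda\to\hat G$ satisfying $q\circ s_1=\mathrm{id}_\Lambda$. Assume there is a relatively compact strict fundamental domain $B$ for the left multiplication action of $\Lambda$ on $Q$ with a finite partition $B=\coprod_{i=1}^pB^i$ into Borel sets such that for each $i$ there is a continuous map $\bar s_2^i\colon\overline{B^i}\to\hat G$ with $q\circ\bar s_2^i=\mathrm{id}_{\overline{B^i}}$. Then for every $\hat G$-quasi-invariant continuous quasimorphism $\phi\colon G\to\mathbb{R}$ there is a continuous quasimorphism $\hat\phi\colon\hat G\to\mathbb{R}$ with $\hat\phi|_G=\phi$ and $D(\hat\phi)\le D(\phi)+3D'(\phi)$.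
   Context: A quasimorphism on a group $G$ is $\phi\colon G\to\mathbb{R}$ with defect $D(\phi)=\sup_{x,y\in G}|\phi(xy)-\phi(x)-\phi(y)|<\infty$. For a normal subgroup $G\trianglelefteq\hat G$, $\phi$ is $\hat G$-quasi-invariant if there is $D'\ge0$ with $|\phi(\hat gx\hat g^{-1})-\phi(x)|\le D'$ for all $\hat g\in\hat G$, $x\in G$; $D'(\phi)$ is the smallest such $D'$. A strict fundamental domain for the action is a subset of $Q$ meeting each $\Lambda$-orbit in exactly one point. *)

(* Defs.v *)
From HB Require Import structures.
From mathcomp Require Import all_boot all_order all_algebra.
From mathcomp Require Import all_classical all_reals all_analysis.
Set Implicit Arguments. Unset Strict Implicit. Unset Printing Implicit Defensive.
Import Order.TTheory GRing.Theory Num.Theory.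
Import numFieldNormedType.Exports.
Local Open Scope classical_set_scope.
Local Open Scope ring_scope.

Definition group_axioms (T : Type) (mul : T -> T -> T) (inv : T -> T) (one : T) :=
  [/\ forall x y z, mul x (mul y z) = mul (mul x y) z,
      forall x, mul one x = x,
      forall x, mul x one = x,
      forall x, mul (inv x) x = one &
      forall x, mul x (inv x) = one].

Definition topological_group (T : topologicalType) (mul : T -> T -> T)
  (inv : T -> T) (one : T) :=
  [/\ group_axioms mul inv one,
      continuous (fun p : T * T => mul p.1 p.2) &
      continuous inv].

Definition subgroup (T : Type) (mul : T -> T -> T) (inv : T -> T) (one : T)
  (S : set T) :=
  S one /\ forall x y, S x -> S y -> S (mul x (inv y)).

Definition discrete_subset (T : topologicalType) (S : set T) :=
  forall x, S x -> exists U : set T, [/\ open U, U x & U `&` S = [set x]].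

Definition group_hom (T U : Type) (mulT : T -> T -> T) (mulU : U -> U -> U)
  (S : set T) (f : T -> U) :=
  forall x y, S x -> S y -> f (mulT x y) = mulU (f x) (f y).

Definition borel_set (T : topologicalType) (A : set T) :=
  <<s [set: T], open >> A.

Definition quasimorphism_on (R : realType) (T : Type) (mul : T -> T -> T)
  (S : set T) (phi : T -> R) :=
  exists D : R, forall x y, S x -> S y ->
    `| phi (mul x y) - phi x - phi y | <= D.

Definition defect (R : realType) (T : Type) (mul : T -> T -> T)
  (S : set T) (phi : T -> R) : R :=
  sup [set `| phi (mul x y) - phi x - phi y | | x in S & y in S].

(* Ghat-quasi-invariance of phi : G -> R, with G = S a subset of Ghat = T. *)
Definition quasi_invariant (R : realType) (T : Type) (mul : T -> T -> T)
  (inv : T -> T) (S : set T) (phi : T -> R) :=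
  exists D' : R, forall g x, S x ->
    `| phi (mul (mul g x) (inv g)) - phi x | <= D'.

Definition qi_defect (R : realType) (T : Type) (mul : T -> T -> T)
  (inv : T -> T) (S : set T) (phi : T -> R) : R :=
  sup [set `| phi (mul (mul g x) (inv g)) - phi x | | g in [set: T] & x in S].

(* Main.v *)
(** Write [k_b(g) = g s(b q(g))^-1 s(b)] for a section [s] of [q] that is
    equivariant under [Lam] acting on the left. This element lies in [G] and
    equals [g] when [g] does, it depends only on the class of [b] in [Lam\Q],
    and [k_b(g h) = k_b(g) . c k_(b q(g))(h) c^-1] for some [c]. Hence
    [F(b, g) = phi (k_b(g))] satisfies
    [|F(b, g h) - F(b, g) - F(b q(g), h)| <= D + D'], and averaging [F] over [b]
    with respect to a mean on [Lam\Q] invariant under right translations by [Q]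
    gives a quasimorphism of defect at most [D + D'] extending [phi].

    For continuity, the single Borel section is replaced by a random one.
    Finitely many closures of pieces of the fundamental domain cover, up to
    [Lam], a compact neighbourhood, so one of them has interior; hence [q] has
    continuous local sections everywhere. Take equivariant local sections [s_i]
    with a [Lam]-invariant partition of unity, cut [0, 1] at each [b] into
    intervals of lengths the weights at [b], and let [t] in [0, 1] select the
    section whose interval contains it: the average of [F] over [t] is then
    jointly continuous, and equal to [phi] on [G].

    The mean comes from the left Haar functional on compactly supported
    functions: Weil's covering numbers give existence, uniqueness shows that
    right translation rescales the functional, and the finite mass of [Lam\Q]
    forces the scale to be 1. *)
Require Import Defs.
From HB Require Import structures.
From mathcomp Require Import all_boot all_order all_algebra.
From mathcomp Require Import all_classical all_reals all_analysis.
From mathcomp Require Import ring lra.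
Set Implicit Arguments. Unset Strict Implicit. Unset Printing Implicit Defensive.
Import Order.TTheory GRing.Theory Num.Theory.
Import numFieldNormedType.Exports.
Local Open Scope classical_set_scope.
Local Open Scope ring_scope.

(** If [P K] failed, the sets [A] with [P (K \ A)] would form a proper filter containing [K]. At a
    cluster point [x], a neighbourhood [U] with [P U] would have to meet its own complement. *)
Lemma compact_ind (T : topologicalType) (K : set T) (P : set T -> Prop) :
  compact K -> P set0 -> (forall A B, P A -> P B -> P (A `|` B)) ->
  (forall A B, A `<=` B -> P B -> P A) ->
  (forall x, K x -> exists2 U, nbhs x U & P U) -> P K.
Proof.
move=> cK P0 PU Psub Ploc; apply: contrapT => nPK.
pose F : set_system T := [set A | P (K `\` A)].
have FF : ProperFilter F.
  apply: Build_ProperFilter_ex => [A FA|].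
    apply: contrapT => nA; apply: nPK; move: FA; rewrite /F /mkset.
    by rewrite (_ : A = set0) ?setD0// -subset0 => x Ax; apply: nA; exists x.
  split.
  - by rewrite /F /mkset setDT.
  - by move=> A B PA PB; rewrite /F /mkset setDIr; apply: PU.
  - by move=> A B AB; apply: Psub; apply: setDS.
have [|x [Kx clx]] := cK F FF; first by rewrite /F /mkset setDv.
have [U Ux PUx] := Ploc x Kx.
have FU : F (~` U) by rewrite /F /mkset setDE setCK; apply: Psub PUx => y [].
by have [y [? ]] := clx _ _ FU Ux.
Qed.

(** * Algebra and limits in a topological group *)

Section TopologicalGroup.
Variables (Q : topologicalType) (mul : Q -> Q -> Q) (inv : Q -> Q) (one : Q).
Hypothesis tgQ : topological_group mul inv one.
Local Notation "x ∙ y" := (mul x y) (at level 40, left associativity).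

Lemma tg_mulA x y z : x ∙ y ∙ z = x ∙ (y ∙ z).
Proof. by case: tgQ => -[]. Qed.
Lemma tg_mul1 x : one ∙ x = x. Proof. by case: tgQ => -[]. Qed.
Lemma tg_mulx1 x : x ∙ one = x. Proof. by case: tgQ => -[]. Qed.
Lemma tg_mulV x : inv x ∙ x = one. Proof. by case: tgQ => -[]. Qed.
Lemma tg_mulxV x : x ∙ inv x = one. Proof. by case: tgQ => -[]. Qed.
Lemma tg_mulKV x y : x ∙ (inv x ∙ y) = y.
Proof. by rewrite -tg_mulA tg_mulxV tg_mul1. Qed.
Lemma tg_mulVK x y : inv x ∙ (x ∙ y) = y.
Proof. by rewrite -tg_mulA tg_mulV tg_mul1. Qed.
Lemma tg_inv_uniq x y : x ∙ y = one -> inv x = y.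
Proof. by move=> xy; rewrite -(tg_mulx1 (inv x)) -xy tg_mulVK. Qed.
Lemma tg_invK x : inv (inv x) = x.
Proof. exact/tg_inv_uniq/tg_mulV. Qed.
Lemma tg_inv1 : inv one = one.
Proof. exact/tg_inv_uniq/tg_mul1. Qed.
Lemma tg_invM x y : inv (x ∙ y) = inv y ∙ inv x.
Proof. by apply: tg_inv_uniq; rewrite tg_mulA tg_mulKV tg_mulxV. Qed.
Definition tgE := (tg_invM, tg_mulA, tg_mulKV, tg_mulVK, tg_mulV, tg_mulxV,
  tg_mul1, tg_mulx1, tg_invK, tg_inv1).

Lemma tg_cvgM (T : Type) (F : set_system T) (FF : Filter F) (f g : T -> Q) a b :
  f @ F --> a -> g @ F --> b -> (fun t => f t ∙ g t) @ F --> a ∙ b.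
Proof. by apply: continuous2_cvg; case: tgQ => _ cm _; apply: (cm (a, b)). Qed.

Lemma tg_cvgV (T : Type) (F : set_system T) (FF : Filter F) (f : T -> Q) a :
  f @ F --> a -> (fun t => inv (f t)) @ F --> inv a.
Proof. by apply: continuous_cvg; case: tgQ => _ _; exact. Qed.

Lemma tg_continuousL y : continuous (fun x => y ∙ x).
Proof. by move=> x; apply: tg_cvgM; [exact: cvg_cst|exact: cvg_id]. Qed.

Lemma tg_continuousR y : continuous (fun x => x ∙ y).
Proof. by move=> x; apply: tg_cvgM; [exact: cvg_id|exact: cvg_cst]. Qed.

Lemma tg_continuousV : continuous inv.
Proof. by case: tgQ. Qed.

End TopologicalGroup.

Arguments tgE {Q mul inv one} tgQ.

(** * Compactly supported functions on a locally compact group *)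

Section CompactSupport.
Variables (R : realType) (Q : topologicalType).
Implicit Types f g : Q -> R.

Definition Cc f :=
  continuous f /\ exists2 K : set Q, compact K & forall x, ~ K x -> f x = 0.

Definition Ccp f := Cc f /\ forall x, 0 <= f x.

Lemma Cc_bounded f : Cc f -> exists2 M, 0 <= M & forall x, `|f x| <= M.
Proof.
move=> [cf [K cK fK]].
have [M M0 KM] : exists2 M, 0 <= M & forall x, K x -> `|f x| <= M.
  apply: (compact_ind (P := fun A => exists2 M : R, 0 <= M & forall x, A x -> `|f x| <= M)) => //.
  - by exists 0.
  - move=> A B [M M0 AM] [N N0 BN]; exists (M + N); first exact: addr_ge0.
    by move=> x [/AM|/BN] fx; lra.
  - by move=> A B AB [M M0 BM]; exists M => // x /AB/BM.
  - move=> x _; exists [set y | `|f x - f y| < 1].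
      by have /cvgrPdist_lt := cf x; apply.
    exists (`|f x| + 1) => [|y /= fxy]; first by rewrite addr_ge0.
    by have := ler_normD (f y - f x) (f x); rewrite subrK distrC; lra.
exists M => // x; have [/KM//|/fK->] := pselect (K x).
by rewrite normr0.
Qed.

Lemma Cc_mul f g : continuous g -> Cc f -> Cc (fun x => f x * g x).
Proof.
move=> cg [cf [K cK fK]]; split; first by move=> x; apply: cvgM; [exact: cf|exact: cg].
by exists K => // x /fK ->; rewrite mul0r.
Qed.

Lemma Cc_scale c f : Cc f -> Cc (fun x => c * f x).
Proof.
move=> /(Cc_mul (@cst_continuous _ _ c)); rewrite (_ : (fun x => _) = fun x => c * f x)//.
by apply/funext => x; rewrite mulrC.
Qed.

Lemma Cc_add f g : Cc f -> Cc g -> Cc (fun x => f x + g x).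
Proof.
move=> [cf [K cK fK]] [cg [L cL gL]].
split; first by move=> x; apply: cvgD; [exact: cf|exact: cg].
exists (K `|` L); first exact: compactU.
by move=> x /not_orP[/fK-> /gL->]; rewrite addr0.
Qed.

Lemma Cc_sub f g : Cc f -> Cc g -> Cc (fun x => f x - g x).
Proof.
move=> Cf /(Cc_scale (-1)) Cg; rewrite (_ : (fun _ => _) = (fun x => f x + -1 * g x)).
  exact: Cc_add.
by apply/funext => x; rewrite mulN1r.
Qed.

Lemma Cc_abs f : Cc f -> Cc (fun x => `|f x|).
Proof.
move=> [cf [K cK fK]]; split; first by move=> x; apply: cvg_norm; exact: cf.
by exists K => // x /fK ->; rewrite normr0.
Qed.

Lemma Cc0 : Cc (fun=> 0).
Proof.
split; first exact: cst_continuous.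
by exists set0 => //; exact: compact0.
Qed.

Lemma Cc_sum (I : Type) (s : seq I) (F : I -> Q -> R) :
  (forall i, Cc (F i)) -> Cc (fun x => \sum_(i <- s) F i x).
Proof.
move=> CF; elim: s => [|i s IH].
  by under eq_fun do rewrite big_nil; exact: Cc0.
by under eq_fun do rewrite big_cons; exact: Cc_add.
Qed.

Lemma Ccp_add f g : Ccp f -> Ccp g -> Ccp (fun x => f x + g x).
Proof. by move=> [Cf f0] [Cg g0]; split; [exact: Cc_add|move=> x; exact: addr_ge0]. Qed.

Lemma Ccp_scale c f : 0 <= c -> Ccp f -> Ccp (fun x => c * f x).
Proof. by move=> c0 [Cf f0]; split; [exact: Cc_scale|move=> x; exact: mulr_ge0]. Qed.

Lemma Cc_comp (h k : Q -> Q) f : continuous h -> continuous k -> cancel h k ->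
  Cc f -> Cc (f \o h).
Proof.
move=> ch ck hk [cf [K cK fK]]; split.
  by move=> x; apply: continuous_comp; [exact: ch|exact: cf].
exists (k @` K); first by apply: continuous_compact => //; exact: continuous_subspaceT.
by move=> x nK; apply: fK => Kx; apply: nK; exists (h x).
Qed.

(** * Translates, uniform continuity and bump functions *)

Section Group.
Variables (mul : Q -> Q -> Q) (inv : Q -> Q) (one : Q).
Hypothesis tgQ : topological_group mul inv one.
Local Notation "x ∙ y" := (mul x y) (at level 40, left associativity).

Lemma Cc_transL y f : Cc f -> Cc (fun x => f (y ∙ x)).
Proof.
apply: (Cc_comp (k := mul (inv y))); try exact: tg_continuousL tgQ _.
by move=> x; rewrite !(tgE tgQ).
Qed.

Lemma Cc_transR y f : Cc f -> Cc (fun x => f (x ∙ y)).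
Proof.
apply: (Cc_comp (h := mul^~ y) (k := mul^~ (inv y))); try exact: tg_continuousR tgQ _.
by move=> x; rewrite !(tgE tgQ).
Qed.

Lemma Cc_inv f : Cc f -> Cc (fun x => f (inv x)).
Proof.
apply: (Cc_comp (h := inv) (k := inv)); try exact: tg_continuousV tgQ.
by move=> x; rewrite !(tgE tgQ).
Qed.

Lemma near_divr (U : set Q) : nbhs one U ->
  exists2 W, nbhs one W & forall x y, W x -> W y -> U (x ∙ inv y).
Proof.
move=> U1; have : \forall z \near (one, one), U (z.1 ∙ inv z.2).
  have : z.1 ∙ inv z.2 @[z --> (one, one)] --> one.
    rewrite -[X in _ --> X](_ : one ∙ inv one = _); last by rewrite !(tgE tgQ).
    apply: (tg_cvgM tgQ); first exact: cvg_fst.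
    by apply: (tg_cvgV tgQ); exact: cvg_snd.
  by apply.
move=> [[A B] /= [A1 B1] AB]; exists (A `&` B); first exact: filterI.
by move=> v w [Av _] [_ Bw]; exact: (AB (v, w)).
Qed.

Lemma near_mulL l x (A : set Q) : nbhs (l ∙ x) A -> \forall y \near x, A (l ∙ y).
Proof. exact: (@tg_continuousL _ _ _ _ tgQ l x A). Qed.

Lemma near_mulR y x (A : set Q) : nbhs (x ∙ y) A -> \forall z \near x, A (z ∙ y).
Proof. exact: (@tg_continuousR _ _ _ _ tgQ y x A). Qed.

Lemma near_inv1 (A : set Q) : nbhs one A -> \forall v \near one, A (inv v).
Proof. by move=> A1; apply: (@tg_continuousV _ _ _ _ tgQ one A); rewrite (tgE tgQ). Qed.

(** On a compact [K] carrying [f], continuity becomes uniform in [x]. For [x] outside [K], either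
    [x ∙ v] is in [K] and the estimate there for [inv v] applies, or both values vanish. *)
Lemma Cc_unifR f e : Cc f -> 0 < e ->
  \forall v \near one, forall x, `|f (x ∙ v) - f x| < e.
Proof.
move=> [cf [K cK fK]] e0.
have nK : \forall v \near one, K `<=` [set x | `|f (x ∙ v) - f x| < e].
  apply: ((iffLR (compact_near_coveringP K)) cK Q (nbhs one)
    (fun v x => `|f (x ∙ v) - f x| < e)) => x Kx.
  have e2 : 0 < e / 2 by rewrite divr_gt0.
  have : \forall y \near (x, one), `|f (y.1 ∙ y.2) - f x| < e / 2.
    have : f (y.1 ∙ y.2) @[y --> (x, one)] --> f x.
      rewrite -{2}(tg_mulx1 tgQ x); apply: (@continuous_cvg _ _ _ _ _ _ f); first exact: cf.
      by apply: (tg_cvgM tgQ); [exact: cvg_fst|exact: cvg_snd].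
    by move=> /cvgr_distC_lt; exact.
  have : \forall y \near (x, one), `|f y.1 - f x| < e / 2.
    have : f y.1 @[y --> (x, one)] --> f x.
      by apply: (@continuous_cvg _ _ _ _ _ _ f); [exact: cf|exact: cvg_fst].
    by move=> /cvgr_distC_lt; exact.
  apply: filterS2 => -[y v] /= h1 h2.
  by have := ler_normB (f (y ∙ v) - f x) (f y - f x); rewrite opprB addrA subrK; lra.
apply: filterS2 nK (near_inv1 nK) => v H1 H2 x.
have [/H1//|nKx] := pselect (K x).
have [/H2|nKxv] := pselect (K (x ∙ v)); first by rewrite /= !(tgE tgQ) distrC.
by rewrite !fK// subrr normr0.
Qed.

Lemma Cc_unifL f e : Cc f -> 0 < e ->
  \forall v \near one, forall x, `|f (v ∙ x) - f x| < e.
Proof.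
move=> /Cc_inv Cf e0; have := near_inv1 (Cc_unifR Cf e0).
by apply: filterS => v h x; have := h (inv x); rewrite !(tgE tgQ).
Qed.

Hypothesis lcQ : locally_compact [set: Q].
Hypothesis hQ : hausdorff_space Q.

Lemma bump_exists (V : set Q) : nbhs one V -> exists psi : Q -> R,
  [/\ continuous psi, forall x, 0 <= psi x, 0 < psi one &
   exists2 K, compact K & K `<=` V /\ forall x, ~ K x -> psi x = 0].
Proof.
move=> V1; have [U] := lcQ (x := one) I; rewrite withinET => U1 [cU clU].
have : nbhs one (V `&` U) by exact: filterI.
rewrite nbhsE => -[W [oW W1] WVU].
have := @locally_compact_completely_regular Q R lcQ hQ one (~` W).
move=> /(_ (open_closedC oW)) /(_ (fun h => h W1)) /(@uniform_separatorP _ R).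
move=> [f [cf f01 fs0 fs1]].
have f10 : f one = 0 by apply: fs0; exists one.
have fW x : ~ W x -> f x = 1 by move=> Ox; apply: fs1; exists x.
(* The bump is twice the positive part of [1/2 - f]. Cutting at one half rather than at 1 confines
   it to the closed set [f <= 1/2], which lies in [W] and in the compact [U]. *)
pose g x := 2^-1 - f x.
have cg : continuous g by move=> x; apply: cvgB; [exact: cvg_cst|exact: cf].
exists (fun x => g x + `|g x|); split.
- by move=> x; apply: cvgD; [exact: cg|apply: cvg_norm; exact: cg].
- by move=> x; have := ler_norm (- g x); rewrite normrN; lra.
- have g1 : g one = 2^-1 by rewrite /g f10 subr0.
  by rewrite g1 gtr0_norm; lra.
- have clK : closed [set x | 0 <= g x].
    by apply: (@preimage_closed _ _ g [set y | 0 <= y]) => [x _|]; [exact: cg|exact: closed_ge].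
  have KW : [set x | 0 <= g x] `<=` W.
    by move=> x /= gx; apply: contrapT => /fW fx; move: gx; rewrite /g fx; lra.
  exists [set x | 0 <= g x].
    by apply: (subclosed_compact clK cU) => x /KW/WVU[].
  split; first by move=> x /KW/WVU[].
  by move=> x /= /negP; rewrite -ltNge => gx; rewrite ltr0_norm ?subrr.
Qed.

Definition wsum (s : seq (R * Q)) (psi : Q -> R) (x : Q) :=
  \sum_(p <- s) p.1 * psi (inv p.2 ∙ x).

Definition nonneg (s : seq (R * Q)) := all (fun p => 0 <= p.1) s.

Lemma wsum_ge0 s psi x : nonneg s -> (forall x, 0 <= psi x) -> 0 <= wsum s psi x.
Proof.
move=> /allP s0 psi0; rewrite /wsum big_seq; apply: sumr_ge0 => p ps.
by rewrite mulr_ge0//; apply: s0.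
Qed.

(** Covering lists of two sets are concatenated, so compactness reduces the claim to one translate
    of [psi], scaled to exceed 1 near its centre. *)
Lemma wsum_cover psi K : compact K -> Ccp psi -> 0 < psi one ->
  exists2 s, nonneg s & forall x, K x -> 1 <= wsum s psi x.
Proof.
move=> cK [Cpsi psi0] psi1.
apply: (compact_ind (P := fun A => exists2 s, nonneg s & forall x, A x -> 1 <= wsum s psi x)) => //.
- by exists [::].
- move=> A B [s s0 sA] [t t0 tB]; exists (s ++ t).
    by rewrite /nonneg all_cat; apply/andP.
  move=> x; rewrite /wsum big_cat -!/(wsum _ _ _) /=.
  have := wsum_ge0 x s0 psi0; have := wsum_ge0 x t0 psi0.
  by move=> ? ? [/sA|/tB]; lra.
- by move=> A B AB [s s0 sB]; exists s => // x /AB/sB.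
- move=> x _; exists [set y | psi one / 2 < psi (inv x ∙ y)].
    apply: (near_mulL (A := [set y | psi one / 2 < psi y])); rewrite (tgE tgQ); have : 0 < psi one / 2 by rewrite divr_gt0.
    have /cvgrPdist_lt h := Cpsi.1 one; move=> /h.
    by apply: filterS => y /=; have := ler_norm (psi one - psi y); lra.
  exists [:: (2 / psi one, x)] => /= [|y /=].
    by rewrite divr_ge0 ?ltW.
  rewrite /wsum big_seq1 /= -(ltr_pM2l (x := 2 / psi one)) ?divr_gt0// => h.
  apply: ltW; apply: le_lt_trans h; rewrite le_eqVlt; apply/orP; left; apply/eqP.
  by field; lra.
Qed.

End Group.
End CompactSupport.

(** * Existence of the Haar functional *)

(** A cluster point along an ultrafilter is a limit, since each preimage or its complement belongs
    to it. This makes all ratios of covering numbers converge along a single ultrafilter. *)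
Lemma ultra_map_cvg (T : Type) (X : topologicalType) (G : set_system T)
  (h : T -> X) (K : set X) :
  UltraFilter G -> compact K -> (\forall t \near G, K (h t)) ->
  exists2 l, K l & h @ G --> l.
Proof.
move=> UG cK GK; have PG := ultra_proper.
have [l [Kl cl]] := cK (h @ G) _ GK.
exists l => // A lA; have [//|nA] := in_ultra_setVsetC (h @^-1` A) UG.
by have [x []] := cl (~` A) A nA lA.
Qed.

Section CoveringNumbers.
Variables (R : realType) (Q : topologicalType).
Variables (mul : Q -> Q -> Q) (inv : Q -> Q) (one : Q).
Hypothesis tgQ : topological_group mul inv one.
Local Notation "x ∙ y" := (mul x y) (at level 40, left associativity).
Local Notation wsum := (@wsum R Q mul inv).
Implicit Types (f g psi : Q -> R) (s t : seq (R * Q)).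

Definition wt s := \sum_(p <- s) p.1.

(* Weil's covering number [(f : psi)]; an entry [(c, y)] of a list stands for
   [c] times the left translate of [psi] by [y]. *)
Definition cov f psi : set (seq (R * Q)) :=
  [set s | nonneg s /\ forall x, f x <= wsum s psi x].

Definition hc f psi := inf [set wt s | s in cov f psi].

Lemma wt_ge0 s : nonneg s -> 0 <= wt s.
Proof.
by move=> /allP s0; rewrite /wt big_seq; apply: sumr_ge0 => p /s0.
Qed.

Lemma wsum_cat s t psi x : wsum (s ++ t) psi x = wsum s psi x + wsum t psi x.
Proof. by rewrite /wsum big_cat. Qed.

Lemma wsum_nil psi : wsum [::] psi = fun=> 0.
Proof. by apply/funext => x; rewrite /wsum big_nil. Qed.

Lemma wsum_cons p s psi :
  wsum (p :: s) psi = fun x => p.1 * psi (inv p.2 ∙ x) + wsum s psi x.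
Proof. by apply/funext => x; rewrite /wsum big_cons. Qed.

Lemma Cc_wsum s psi : Cc psi -> Cc (wsum s psi).
Proof.
by move=> Cpsi; apply: Cc_sum => p; apply: Cc_scale; exact: (Cc_transL tgQ).
Qed.

Lemma wt_cat s t : wt (s ++ t) = wt s + wt t.
Proof. by rewrite /wt big_cat. Qed.

Definition scale_seq (c : R) s := [seq (c * p.1, p.2) | p <- s].

Lemma wsum_scale c s psi x : wsum (scale_seq c s) psi x = c * wsum s psi x.
Proof.
rewrite /wsum big_map mulr_sumr.
by apply: eq_bigr => p _ /=; rewrite mulrA.
Qed.

Lemma wt_scale c s : wt (scale_seq c s) = c * wt s.
Proof. by rewrite /wt big_map mulr_sumr. Qed.

Lemma nonneg_scale c s : 0 <= c -> nonneg s -> nonneg (scale_seq c s).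
Proof.
move=> c0 /allP s0; apply/allP => _ /mapP[p ps ->] /=.
by rewrite mulr_ge0//; exact: s0.
Qed.

Lemma nonneg_cat s t : nonneg s -> nonneg t -> nonneg (s ++ t).
Proof. by move=> s0 t0; rewrite /nonneg all_cat; apply/andP. Qed.

Lemma hc_le f psi s : cov f psi s -> hc f psi <= wt s.
Proof.
move=> fs; apply: ge_inf; last by exists s.
by exists 0 => _ [t [t0 _] <-]; exact: wt_ge0.
Qed.

Definition bumpish psi := Ccp psi /\ 0 < psi one.

Lemma cov_ex f psi : Cc f -> bumpish psi -> cov f psi !=set0.
Proof.
move=> Cf [Cpsi psi1]; have [M M0 fM] := Cc_bounded Cf.
have [K cK fK] := Cf.2; have [s s0 sK] := wsum_cover tgQ cK Cpsi psi1.
exists (scale_seq M s); split; first exact: nonneg_scale.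
move=> x; rewrite wsum_scale; have [Kx|/fK->] := pselect (K x).
  by rewrite (le_trans (ler_norm _))// (le_trans (fM x))// ler_peMr// sK.
by rewrite mulr_ge0// wsum_ge0//; exact: Cpsi.2.
Qed.

Lemma hc_ge f psi m : Cc f -> bumpish psi ->
  (forall s, cov f psi s -> m <= wt s) -> m <= hc f psi.
Proof.
move=> Cf bpsi fm; apply: lb_le_inf; last by move=> _ [s /fm + <-].
by have [s fs] := cov_ex Cf bpsi; exists (wt s), s.
Qed.

Lemma hc_ge0 f psi : Cc f -> bumpish psi -> 0 <= hc f psi.
Proof. by move=> Cf bpsi; apply: hc_ge => // s [/wt_ge0]. Qed.

Lemma hc_le_add f g psi s : Cc g -> bumpish psi -> nonneg s ->
  (forall x, f x <= wsum s psi x + g x) -> hc f psi <= wt s + hc g psi.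
Proof.
move=> Cg bpsi s0 fsg; rewrite -lerBlDl; apply: hc_ge => // t [t0 gt].
rewrite lerBlDl -wt_cat; apply: hc_le; split; first exact: nonneg_cat.
by move=> x; rewrite wsum_cat (le_trans (fsg x))// lerD2l.
Qed.

Lemma hc_add f g psi : Cc f -> Cc g -> bumpish psi ->
  hc (fun x => f x + g x) psi <= hc f psi + hc g psi.
Proof.
move=> Cf Cg bpsi; rewrite -lerBlDr; apply: hc_ge => // s [s0 fs].
by rewrite lerBlDr; apply: hc_le_add => // x; rewrite lerD2r.
Qed.

Lemma hc_mono f g psi : Cc g -> bumpish psi -> (forall x, f x <= g x) ->
  hc f psi <= hc g psi.
Proof.
move=> Cg bpsi fg; have := @hc_le_add f g psi [::] Cg bpsi isT.
by rewrite /wt /wsum big_nil add0r; apply => x; rewrite big_nil add0r.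
Qed.

Lemma hc_scale c f psi : 0 <= c -> Cc f -> bumpish psi ->
  hc (fun x => c * f x) psi <= c * hc f psi.
Proof.
rewrite le_eqVlt => /predU1P[<- Cf bpsi|c0 Cf bpsi].
  rewrite mul0r; apply: (@le_trans _ _ (wt [::])); last by rewrite /wt big_nil.
  by apply: hc_le; split => // x; rewrite mul0r /wsum big_nil.
rewrite mulrC -ler_pdivrMr//; apply: hc_ge => // s [s0 fs].
rewrite ler_pdivrMr// mulrC -wt_scale; apply: hc_le; split.
  by apply: nonneg_scale => //; exact: ltW.
by move=> x; rewrite wsum_scale ler_pM2l.
Qed.

Lemma hc_transL_le y f psi : Cc f -> bumpish psi ->
  hc (fun x => f (y ∙ x)) psi <= hc f psi.
Proof.
move=> Cf bpsi; apply: hc_ge => // s [s0 fs].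
pose s' := [seq (p.1, inv y ∙ p.2) | p <- s].
have -> : wt s = wt s' by rewrite /wt big_map.
apply: hc_le; split => [|x].
  by apply/allP => _ /mapP[p ps ->] /=; exact: (allP s0).
rewrite (le_trans (fs _))// le_eqVlt; apply/orP; left; apply/eqP.
by rewrite /wsum big_map; apply: eq_bigr => p _ /=; rewrite !(tgE tgQ).
Qed.

Lemma hc_transL y f psi : Cc f -> bumpish psi ->
  hc (fun x => f (y ∙ x)) psi = hc f psi.
Proof.
move=> Cf bpsi; apply/eqP; rewrite eq_le hc_transL_le//=.
have := @hc_transL_le (inv y) (fun x => f (y ∙ x)) psi (Cc_transL tgQ y Cf) bpsi.
by under eq_fun do rewrite !(tgE tgQ).
Qed.

(** Each translate of [g] in a cover of [f] can be replaced by a cover of [g]. With [g] fixed, this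
    bounds [(f : psi) / (g : psi)] independently of [psi], so that the ratios stay in a compact
    interval. *)
Lemma hc_comp f g psi : Cc f -> bumpish g -> bumpish psi ->
  hc f psi <= hc f g * hc g psi.
Proof.
move=> Cf bg bpsi.
have Cg := bg.1.1.
have H s : nonneg s -> hc (wsum s g) psi <= wt s * hc g psi.
  elim: s => [_|p s IH /= /andP[p0 s0]].
    rewrite wsum_nil /wt big_nil mul0r -[leRHS](mul0r (hc (fun=> 0) psi)).
    apply: le_trans (hc_scale (lexx 0) (Cc0 _ _) bpsi).
    apply: hc_mono => //; first by apply: Cc_scale; exact: Cc0.
  rewrite /wt big_cons mulrDl wsum_cons.
  apply: le_trans (hc_add _ _ _) _ => //.
  - by apply: Cc_scale; exact: (Cc_transL tgQ).
  - exact: Cc_wsum.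
  apply: lerD; last exact: IH.
  apply: le_trans (hc_scale _ _ _) _ => //; first exact: (Cc_transL tgQ).
  by rewrite hc_transL.
have : 0 <= hc g psi by exact: hc_ge0.
rewrite le_eqVlt => /predU1P[g0|g0].
  rewrite -g0 mulr0; have [s [s0 fs]] := cov_ex Cf bg.
  have := H _ s0; rewrite -g0 mulr0; apply: le_trans; apply: hc_mono => //.
  exact: Cc_wsum.
rewrite -ler_pdivrMr//; apply: hc_ge => // s [s0 fs].
rewrite ler_pdivrMr//; apply: le_trans (H _ s0); apply: hc_mono => //.
exact: Cc_wsum.
Qed.

(** Translates of [psi] are at most [M], so a cover evaluated at [x] must have weight at least
    [f x / M]. *)
Lemma hc_gt0 f psi x : Cc f -> bumpish psi -> 0 < f x -> 0 < hc f psi.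
Proof.
move=> Cf bpsi fx; have [M M0 psiM] := Cc_bounded bpsi.1.1.
have M1 : 0 < M by apply: lt_le_trans bpsi.2 _; apply: le_trans (psiM one); exact: ler_norm.
apply: (@lt_le_trans _ _ (f x / M)); first by rewrite divr_gt0.
apply: hc_ge => // s [s0 fs]; rewrite ler_pdivrMr// (le_trans (fs x))//.
rewrite /wt mulr_suml /wsum !big_seq; apply: ler_sum => p ps.
rewrite ler_wpM2l//; first exact: (allP s0).
by apply: le_trans (psiM _); exact: ler_norm.
Qed.

Definition supported (V : set Q) psi := forall x, psi x != 0 -> V x.

(* The quotients [f_i / (f1 + f2 + e)] are nearly constant on translates of a
   small [V], so a cover of [f1 + f2] by such translates splits into covers of
   [f1] and [f2]. *)
Lemma hc_superadd f1 f2 k e : Ccp f1 -> Ccp f2 -> Ccp k ->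
  (forall x, f1 x + f2 x != 0 -> 1 <= k x) -> 0 < e ->
  exists2 V, nbhs one V & forall psi, bumpish psi -> supported V psi ->
    hc f1 psi + hc f2 psi <= (1 + e) * hc (fun x => f1 x + f2 x) psi
       + 2 * e * hc k psi.
Proof.
move=> Cf1 Cf2 Ck fk e0.
pose d x := f1 x + f2 x + e.
have d0 x : 0 < d x by rewrite ltr_wpDl// addr_ge0//; [exact: Cf1.2|exact: Cf2.2].
have cd : continuous (fun x => (d x)^-1).
  move=> x; apply: cvgV; first by rewrite gt_eqF.
  by apply: cvgD; [apply: cvgD; [exact: Cf1.1.1|exact: Cf2.1.1]|exact: cvg_cst].
have Ch f : Ccp f -> Ccp (fun x => f x / d x).
  by move=> [Cf f0]; split; [exact: Cc_mul|move=> x; rewrite divr_ge0// ltW].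
have e2 : 0 < e / 2 by rewrite divr_gt0.
have Ch1 := Ch _ Cf1; have Ch2 := Ch _ Cf2.
pose V := [set v | (forall x, `|f1 (x ∙ v) / d (x ∙ v) - f1 x / d x| < e / 2) /\
  (forall x, `|f2 (x ∙ v) / d (x ∙ v) - f2 x / d x| < e / 2)].
exists V.
  by apply: filterI; [exact: (Cc_unifR tgQ Ch1.1)|exact: (Cc_unifR tgQ Ch2.1)].
move=> psi bpsi Vpsi.
have psi0 := bpsi.1.2.
rewrite -lerBlDr [(1 + e) * _]mulrC -ler_pdivrMr; last by rewrite addr_gt0.
apply: hc_ge => //; first by apply: Cc_add; [exact: Cf1.1|exact: Cf2.1].
move=> s [s0 fs]; rewrite ler_pdivrMr; last by rewrite addr_gt0.
rewrite lerBlDr.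
have key f : Ccp f -> (forall x, f x <= f1 x + f2 x) ->
   (forall v x, V v -> `|f (x ∙ v) / d (x ∙ v) - f x / d x| < e / 2) ->
   hc f psi <= wt [seq (p.1 * (f p.2 / d p.2 + e / 2), p.2) | p <- s] + e * hc k psi.
  move=> Cf ff Vf; have [Ch' h0] := Ch _ Cf.
  have fdk x : f x / d x <= k x.
    have [fx0|fx0] := eqVneq (f1 x + f2 x) 0.
      rewrite (_ : f x = 0) ?mul0r; first exact: Ck.2.
      by apply/eqP; rewrite eq_le Cf.2 andbT -fx0 ff.
    apply: le_trans (fk x fx0); rewrite ler_pdivrMr// mul1r.
    by rewrite (le_trans (ff x))// lerDl ltW.
  apply: (@le_trans _ _ (wt [seq (p.1 * (f p.2 / d p.2 + e / 2), p.2) | p <- s]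
     + hc (fun x => e * (f x / d x)) psi)); last first.
    rewrite lerD2l (le_trans (hc_scale _ _ _))//; first exact: ltW.
    by rewrite ler_pM2l// hc_mono//; exact: Ck.1.
  apply: hc_le_add => //; first exact: Cc_scale.
    apply/allP => _ /mapP[p ps ->] /=.
    apply: mulr_ge0; first exact: (allP s0).
    by apply: addr_ge0; [exact: h0|exact: ltW].
  (* The part with [f1 + f2] is covered by reweighting [s]; the part with [e], due to the [e] that
     keeps [d] away from 0, is at most [e * k]. *)
  move=> x; have {1}-> : f x = f x / d x * (f1 x + f2 x) + e * (f x / d x).
    by rewrite [e * _]mulrC -mulrDr -/(d x) divfK// gt_eqF.
  rewrite lerD2r; apply: (@le_trans _ _ (f x / d x * wsum s psi x)).
    by rewrite ler_wpM2l//; exact: h0.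
  rewrite /wsum big_map mulr_sumr !big_seq; apply: ler_sum => p ps /=.
  rewrite mulrCA -mulrA ler_wpM2l//; first exact: (allP s0).
  have [->|px] := eqVneq (psi (inv p.2 ∙ x)) 0; first by rewrite !mulr0.
  rewrite ler_wpM2r// ltW//.
  have := Vf _ p.2 (Vpsi _ px); rewrite !(tgE tgQ).
  by have := ler_norm (f x / d x - f p.2 / d p.2); lra.
have k1 := key f1 Cf1 (fun x => ltac:(by rewrite lerDl; exact: Cf2.2)) (fun v x Vv => Vv.1 x).
have k2 := key f2 Cf2 (fun x => ltac:(by rewrite lerDr; exact: Cf1.2)) (fun v x Vv => Vv.2 x).
apply: le_trans (lerD k1 k2) _.
rewrite addrACA (_ : 2 * e * hc k psi = e * hc k psi + e * hc k psi); last by ring.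
rewrite lerD2r.
rewrite /wt !big_map /= -big_split mulr_suml /= !big_seq; apply: ler_sum => p ps.
rewrite -mulrDr ler_wpM2l//; first exact: (allP s0).
(* The two quotients at [p.2] add up to at most 1, the two tolerances [e / 2] to [e]. *)
rewrite addrACA -splitr lerD2r -mulrDl ler_pdivrMr// mul1r.
by rewrite lerDl ltW.
Qed.
End CoveringNumbers.

(** A left Haar measure is represented by its integral; values of [J] outside [Cc] are
    unconstrained. *)
Definition haar_functional (R : realType) (Q : topologicalType)
  (mul : Q -> Q -> Q) (J : (Q -> R) -> R) :=
  [/\ forall f g, Cc f -> Cc g -> J (fun x => f x + g x) = J f + J g,
      forall c f, Cc f -> J (fun x => c * f x) = c * J f,
      forall f, Ccp f -> 0 <= J f,
      forall y f, Cc f -> J (fun x => f (mul y x)) = J f &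
      exists2 f, Ccp f & J f != 0].

Lemma ler_addgt_mul (R : realType) (a b c : R) : 0 <= c ->
  (forall e, 0 < e -> a <= b + e * c) -> a <= b.
Proof.
move=> c0 h; apply/ler_addgt0Pr => e e0.
have c1 : 0 < c + 1 by rewrite ltr_wpDl.
apply: le_trans (h (e / (c + 1)) _) _; first by rewrite divr_gt0.
by rewrite lerD2l mulrAC ler_pdivrMr// ler_pM2l// lerDl.
Qed.

Section HaarFunctional.
Variables (R : realType) (Q : topologicalType).
Variables (mul : Q -> Q -> Q) (inv : Q -> Q) (one : Q).
Hypothesis tgQ : topological_group mul inv one.
Hypothesis lcQ : locally_compact [set: Q].
Hypothesis hQ : hausdorff_space Q.
Implicit Types (f g psi : Q -> R).
Local Notation hc := (@hc R Q mul inv).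
Local Notation bumpish := (@bumpish R Q one).

Lemma bumpish_exists (V : set Q) : nbhs one V ->
  exists2 psi, bumpish psi & supported V psi.
Proof.
move=> /(bump_exists R lcQ hQ)[psi [cpsi psi0 psi1 [K cK [KV Kpsi]]]].
exists psi; first by split=> //; split=> //; split=> //; exists K.
by move=> x; apply: contra_neqP => nVx; apply: Kpsi => /KV.
Qed.

Lemma Ccp_majorant K : compact K ->
  exists2 k : Q -> R, Ccp k & forall x, K x -> 1 <= k x.
Proof.
move=> cK; have [psi [Cpsi psi1] _] := @bumpish_exists setT filterT.
have [s s0 sK] := wsum_cover tgQ cK Cpsi psi1.
exists (wsum mul inv s psi) => //; split; first exact: (Cc_wsum tgQ _ Cpsi.1).
by move=> x; apply: wsum_ge0 => // y; exact: Cpsi.2.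
Qed.

(* [J f] is the limit of [(f : psi) / (f0 : psi)] along an ultrafilter of bumps
   [psi] shrinking to [one]. *)
Lemma haar_cone : exists J : (Q -> R) -> R,
  [/\ forall f g, Ccp f -> Ccp g -> J (fun x => f x + g x) = J f + J g,
      forall c f, 0 <= c -> Ccp f -> J (fun x => c * f x) <= c * J f,
      forall f, Ccp f -> 0 <= J f,
      forall y f, Ccp f -> J (fun x => f (mul y x)) = J f &
      exists2 f, Ccp f & J f = 1].
Proof.
have [f0 bf0 _] := @bumpish_exists setT filterT.
pose base (V : set Q) := [set psi : Q -> R | bumpish psi /\ supported V psi].
have PF : ProperFilter (filter_from (nbhs one) base).
  apply: filter_from_proper => [|V V1]; last first.
    by have [psi bp Vp] := bumpish_exists V1; exists psi.
  apply: filter_from_filter; first by exists setT; exact: filterT.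
  move=> V W V1 W1; exists (V `&` W); first exact: filterI.
  by move=> psi [bp VW]; split; split=> // x /VW[].
have [G [UG sG]] := ultraFilterLemma PF.
have PG : ProperFilter G by exact: (@ultra_proper _ _ UG).
have Gbase V : nbhs one V -> \forall psi \near G, bumpish psi /\ supported V psi.
  by move=> V1; apply: sG; exists V.
have Gbump : \forall psi \near G, bumpish psi.
  by apply: filterS (Gbase setT filterT) => psi [].
pose r (f psi : Q -> R) : R := hc f psi / hc f0 psi.
have hf0 psi : bumpish psi -> 0 < hc f0 psi.
  by move=> bp; apply: (@hc_gt0 _ _ _ _ _ tgQ f0 psi one bf0.1.1 bp bf0.2).
have rcvg f : Ccp f -> r f @ G --> lim (r f @ G).
  move=> Cf; have [|l _ /cvgP//] := @ultra_map_cvg _ _ G (r f) `[0, hc f f0]%classic UG (@segment_compact _ _ _).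
  apply: filterS Gbump => psi bp.
  rewrite /= in_itv /=; apply/andP; split.
    by rewrite divr_ge0// ?(hc_ge0 tgQ Cf.1 bp)// ltW// hf0.
  by rewrite ler_pdivrMr ?hf0//; apply: (hc_comp tgQ Cf.1 bf0 bp).
pose J f : R := lim (r f @ G).
have rJ f : Ccp f -> (fun psi => r f psi) @ G --> J f by exact: rcvg.
have J0 f : Ccp f -> 0 <= J f.
  move=> Cf; apply: (cvgr_to_ge (rJ f Cf)); apply: filterS Gbump => psi bp.
  by rewrite divr_ge0// ?(hc_ge0 tgQ Cf.1 bp)// ltW// hf0.
exists J; split => //.
- move=> f g Cf Cg; have Cfg := Ccp_add Cf Cg.
  apply/eqP; rewrite eq_le; apply/andP; split.
    rewrite -subr_ge0; apply: (@cvgr_to_ge _ G PG _ (fun psi => r f psi + r g psi - r (fun x => f x + g x) psi)).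
      apply: cvgB; last by apply: rJ.
      by apply: cvgD; exact: rJ.
    apply: filterS Gbump => psi bp; rewrite subr_ge0 -mulrDl ler_wpM2r//.
      by rewrite invr_ge0 ltW// hf0.
    exact: (hc_add tgQ Cf.1 Cg.1 bp).
  have [K cK fgK] := Cfg.1.2; have [k Ck kK] := Ccp_majorant cK.
  (* Bumps small enough for the error [e] are in the ultrafilter, so superadditivity with that error
     passes to the limit before [e] tends to 0. *)
  apply: (@ler_addgt_mul _ _ _ (J (fun x => f x + g x) + 2 * J k)).
    by rewrite addr_ge0 ?mulr_ge0 ?J0.
  move=> e e0; have [x|V V1 HV] := hc_superadd tgQ Cf Cg Ck _ e0.
    by move=> fgx; apply: kK; apply: contrapT => /fgK fgx0; rewrite fgx0 eqxx in fgx.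
  rewrite -subr_ge0; apply: (@cvgr_to_ge _ G PG _ (fun psi => r (fun x => f x + g x) psi + e * (r (fun x => f x + g x) psi + 2 * r k psi) - (r f psi + r g psi))).
    apply: cvgB; last by apply: cvgD; exact: rJ.
    apply: cvgD; first exact: rJ.
    apply: cvgM; first exact: cvg_cst.
    apply: cvgD; first exact: rJ.
    by apply: cvgM; [exact: cvg_cst|exact: rJ].
  apply: filterS (Gbase V V1) => psi [bp Vpsi]; rewrite subr_ge0.
  have := HV psi bp Vpsi; rewrite -(ler_pM2r (x := (hc f0 psi)^-1)) ?invr_gt0 ?hf0//.
  by rewrite mulrDl => /le_trans; apply; rewrite /r; nra.
- move=> c f c0 Cf; rewrite -subr_ge0.
  apply: (@cvgr_to_ge _ G PG _ (fun psi => c * r f psi - r (fun x => c * f x) psi)).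
    apply: cvgB; last by apply: rJ; exact: Ccp_scale.
    by apply: cvgM; [exact: cvg_cst|exact: rJ].
  apply: filterS Gbump => psi bp; rewrite subr_ge0 mulrA ler_wpM2r//.
    by rewrite invr_ge0 ltW// hf0.
  exact: (hc_scale tgQ c0 Cf.1 bp).
- move=> y f Cf; apply: cvg_lim => //.
  apply: cvg_trans (rJ f Cf); apply: near_eq_cvg.
  by apply: filterS Gbump => psi bp; rewrite /r (hc_transL tgQ y Cf.1 bp).
- exists f0; first exact: bf0.1.
  apply: cvg_lim => //; apply: cvg_near_cst; apply: filterS Gbump => psi bp.
  by rewrite /r divff// gt_eqF// hf0.
Qed.

(** Any [f] in [Cc] is the difference of [|f| + f] and [|f|], both in the cone. Additivity makes the
    value independent of the decomposition ([JE]), whence linearity. *)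
Lemma haar_exists : exists J : (Q -> R) -> R, haar_functional mul J.
Proof.
have [J0 [J0D J0Z J0p J0L [f0 Cf0 J0f0]]] := haar_cone.
have nnC f : Cc f -> Ccp (fun x => `|f x| + f x).
  move=> Cf; split; first by apply: Cc_add => //; exact: Cc_abs.
  by move=> x; have := ler_norm (- f x); rewrite normrN; lra.
have absC f : Cc f -> Ccp (fun x => `|f x|).
  by move=> Cf; split=> //; exact: Cc_abs.
pose J f : R := J0 (fun x => `|f x| + f x) - J0 (fun x => `|f x|).
have JE f a b : Ccp a -> Ccp b -> Cc f -> (forall x, f x = a x - b x) -> J f = J0 a - J0 b.
  move=> Ca Cb Cf fab; have := J0D _ _ (nnC f Cf) Cb.
  rewrite (_ : (fun x => _) = (fun x => `|f x| + a x)); last first.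
    by apply/funext => x; rewrite fab; ring.
  by rewrite J0D//; [rewrite /J; lra|exact: absC].
have J00 : J0 (fun=> 0) = 0.
  have C0 : Ccp (fun _ : Q => 0 : R) by split; [exact: Cc0|].
  have := J0D _ _ C0 C0; rewrite (_ : (fun x : Q => 0 + 0) = fun=> 0); first by lra.
  by apply/funext => x; rewrite addr0.
have JEp f : Ccp f -> J f = J0 f.
  move=> Cf; rewrite -[RHS]subr0 -J00; apply: JE => //; last by move=> x; rewrite subr0.
    by split; [exact: Cc0|].
  exact: Cf.1.
have JD f g : Cc f -> Cc g -> J (fun x => f x + g x) = J f + J g.
  move=> Cf Cg; have Cnf := nnC f Cf; have Cng := nnC g Cg.
  have Caf := absC f Cf; have Cag := absC g Cg.
  rewrite (JE _ (fun x => `|f x| + f x + (`|g x| + g x)) (fun x => `|f x| + `|g x|)).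
  - by rewrite (J0D _ _ Cnf Cng) (J0D _ _ Caf Cag) /J; lra.
  - exact: Ccp_add.
  - exact: Ccp_add.
  - exact: Cc_add.
  - by move=> x; ring.
have J0ZE c f : 0 <= c -> Ccp f -> J0 (fun x => c * f x) = c * J0 f.
  rewrite le_eqVlt => /predU1P[<- Cf|c0 Cf].
    by rewrite mul0r -[RHS]J00; congr J0; apply/funext => x; rewrite mul0r.
  apply/eqP; rewrite eq_le (J0Z c f (ltW c0) Cf) /=.
  have := J0Z c^-1 (fun x => c * f x); rewrite invr_ge0 ltW// => /(_ isT).
  move=> /(_ (Ccp_scale (ltW c0) Cf)).
  rewrite (_ : (fun x => c^-1 * (c * f x)) = f).
    by rewrite ler_pdivlMl.
  by apply/funext => x; rewrite mulKf// gt_eqF.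
have JZp c f : 0 <= c -> Cc f -> J (fun x => c * f x) = c * J f.
  move=> c0 Cf; have Cnf := nnC f Cf; have Caf := absC f Cf.
  rewrite (JE _ (fun x => c * (`|f x| + f x)) (fun x => c * `|f x|)).
  - by rewrite !J0ZE// /J; ring.
  - exact: Ccp_scale.
  - exact: Ccp_scale.
  - exact: Cc_scale.
  - by move=> x; ring.
exists J; split => //.
- move=> c f Cf; have [c0|/ltW c0] := leP 0 c; first exact: JZp.
  have Nc0 : 0 <= - c by lra.
  have := JD _ _ (Cc_scale c Cf) (Cc_scale (- c) Cf).
  rewrite (JZp (- c))// (_ : (fun x => _ + _) = fun=> 0).
    by rewrite JEp ?J00; [lra|split; [exact: Cc0|]].
  by apply/funext => x; ring.
- by move=> f Cf; rewrite JEp//; exact: J0p.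
- move=> y f Cf; rewrite /J.
  by rewrite (J0L y (fun x => `|f x| + f x) (nnC f Cf)) (J0L y (fun x => `|f x|) (absC f Cf)).
- by exists f0 => //; rewrite JEp// J0f0 oner_neq0.
Qed.
End HaarFunctional.

(** * Uniqueness of the Haar functional *)

Section HaarUniqueness.
Variables (R : realType) (Q : topologicalType).
Variables (mul : Q -> Q -> Q) (inv : Q -> Q) (one : Q).
Hypothesis tgQ : topological_group mul inv one.
Hypothesis lcQ : locally_compact [set: Q].
Hypothesis hQ : hausdorff_space Q.
Implicit Types (f g psi : Q -> R) (J : (Q -> R) -> R).
Local Notation "x ∙ y" := (mul x y) (at level 40, left associativity).
Local Notation bumpish := (@bumpish R Q one).

Lemma haar_sub J f g : haar_functional mul J -> Cc f -> Cc g ->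
  J (fun x => f x - g x) = J f - J g.
Proof.
move=> [JD JZ _ _ _] Cf Cg.
rewrite (_ : (fun x => _) = (fun x => f x + -1 * g x)).
  by rewrite (JD f (fun x => -1 * g x) Cf (Cc_scale _ Cg)) JZ// mulN1r.
by apply/funext => x; rewrite mulN1r.
Qed.

Lemma haar_mono J f g : haar_functional mul J -> Cc f -> Cc g ->
  (forall x, f x <= g x) -> J f <= J g.
Proof.
move=> hJ Cf Cg fg; rewrite -subr_ge0 -haar_sub//.
case: hJ => _ _ Jp _ _; apply: Jp; split; first exact: Cc_sub.
by move=> x; rewrite subr_ge0.
Qed.

Lemma haar_abs J f g : haar_functional mul J -> Cc f -> Cc g ->
  (forall x, `|f x| <= g x) -> `|J f| <= J g.
Proof.
move=> hJ Cf Cg fg; have [_ JZ _ _ _] := hJ.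
rewrite ler_norml -mulN1r -JZ//; apply/andP; split.
  by apply: haar_mono => //; [exact: Cc_scale|move=> x; have := fg x; rewrite ler_norml; lra].
by apply: haar_mono => // x; apply: le_trans (fg x); exact: ler_norm.
Qed.

Lemma haar0 J : haar_functional mul J -> J (fun=> 0) = 0.
Proof.
move=> [_ JZ _ _ _]; rewrite (_ : (fun=> 0) = (fun x : Q => 0 * (0 : R))).
  by rewrite (JZ 0 (fun=> 0) (Cc0 _ _)) mul0r.
by apply/funext => x; rewrite mul0r.
Qed.

Lemma haar_sum J (I : Type) (s : seq I) (F : I -> Q -> R) :
  haar_functional mul J -> (forall i, Cc (F i)) ->
  J (fun x => \sum_(i <- s) F i x) = \sum_(i <- s) J (F i).
Proof.
move=> hJ CF; have [JD _ _ _ _] := hJ; elim: s => [|i s IH].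
  rewrite big_nil -[RHS](haar0 hJ); congr J.
  by apply/funext => x; rewrite big_nil.
rewrite big_cons -IH -JD//; last exact: Cc_sum.
by congr J; apply/funext => x; rewrite big_cons.
Qed.

(** Some nonnegative function has positive integral; it is dominated by a combination of finitely
    many translates of [psi], each of integral [J psi]. *)
Lemma haar_gt0 J psi : haar_functional mul J -> bumpish psi -> 0 < J psi.
Proof.
move=> hJ bpsi; have [_ JZ Jp JL [f Cf Jf]] := hJ.
have Cpsi := bpsi.1.1.
have [s [s0 fs]] := cov_ex tgQ Cf.1 bpsi.
have Jf0 : 0 < J f by rewrite lt_def Jf Jp.
have : J f <= wt s * J psi.
  apply: le_trans (haar_mono hJ Cf.1 (Cc_wsum tgQ s Cpsi) fs) _.
  rewrite /wsum haar_sum//; last by move=> p; apply: Cc_scale; exact: (Cc_transL tgQ).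
  rewrite /wt mulr_suml; apply: ler_sum => p _.
  by rewrite (JZ p.1 (fun x => psi (inv p.2 ∙ x)) (Cc_transL tgQ _ Cpsi)) JL.
move=> /(lt_le_trans Jf0); have : 0 <= wt s := wt_ge0 s0.
rewrite le_eqVlt => /predU1P[<-|w0]; first by rewrite mul0r ltxx.
by rewrite pmulr_rgt0.
Qed.

(** Symmetrising a bump lets [psi (inv x ∙ y)] be read as [psi (inv y ∙ x)], so the comparison of
    two functionals involves no modular function. *)
Lemma bumpish_sym_exists (V : set Q) : nbhs one V ->
  exists psi, [/\ bumpish psi, supported V psi & forall x, psi (inv x) = psi x].
Proof.
move=> V1; have : nbhs one (V `&` [set v | V (inv v)]).
  by apply: filterI => //; exact: near_inv1 tgQ _ V1.
move=> /(bumpish_exists R lcQ hQ)[psi [[Cpsi p0] p1] Vpsi].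
exists (fun x => psi x + psi (inv x)); split.
- split; last by rewrite (tgE tgQ) addr_gt0.
  apply: Ccp_add => //; split; last by move=> x.
  exact: (Cc_inv tgQ).
- move=> x; have [->|/Vpsi[]//] := eqVneq (psi x) 0.
  by rewrite add0r => /Vpsi[_] /=; rewrite (tgE tgQ).
- by move=> x; rewrite (tgE tgQ) addrC.
Qed.

Lemma partition_of_unity (L W : set Q) : compact L -> nbhs one W ->
  exists (s : seq (R * Q)) (b : R * Q -> Q -> R),
  [/\ forall p, continuous (b p), forall p x, p \in s -> 0 <= b p x,
      forall p x, b p x != 0 -> W (inv p.2 ∙ x) &
      forall x, L x -> \sum_(p <- s) b p x = 1].
Proof.
move=> cL W1; have [eta [Ceta eta1] Weta] := bumpish_exists R lcQ hQ W1.
have [s s0 sL] := wsum_cover tgQ cL Ceta eta1.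
pose w := wsum mul inv s eta.
have [cw _] := Cc_wsum tgQ s Ceta.1; rewrite -/w in cw.
(* This is the maximum of [w] and 1: dividing by it is continuous everywhere and gives sum 1 on [L],
   where [w >= 1]. *)
pose m x := (w x + 1 + `|w x - 1|) / 2.
have m1 x : 1 <= m x.
  by rewrite /m; have := ler_norm (1 - w x); rewrite distrC; lra.
have cm : continuous (fun x => (m x)^-1).
  move=> x; apply: cvgV; first by rewrite gt_eqF// (lt_le_trans ltr01).
  apply: cvgM; last exact: cvg_cst.
  have cwx : w x @[x --> x] --> w x by exact: cw.
  apply: cvgD; first by apply: cvgD => //; exact: cvg_cst.
  by apply: cvg_norm; apply: cvgB => //; exact: cvg_cst.
exists s, (fun p x => p.1 * eta (inv p.2 ∙ x) * (m x)^-1); split.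
- move=> p x; apply: cvgM; last exact: cm.
  apply: cvgM; first exact: cvg_cst.
  exact: (Cc_transL tgQ (inv p.2) Ceta.1).1.
- move=> p x ps; apply: mulr_ge0; last by rewrite invr_ge0 (le_trans ler01).
  by apply: mulr_ge0; [exact: (allP s0)|exact: Ceta.2].
- by move=> p x; rewrite !mulf_eq0 !negb_or => /andP[/andP[_ /Weta]].
- move=> x Lx; rewrite -mulr_suml -/(wsum mul inv s eta x) -/(w x).
  have w1 : 1 <= w x by exact: sL.
  rewrite (_ : m x = w x) ?divff// ?gt_eqF//; first by lra.
  by rewrite /m ger0_norm; lra.
Qed.

(* Discretised Fubini: up to [e], [f * J1 psi] is the combination of translates
   of [psi] with weights [J1 (f * b_p)], [b] a fine partition of unity, and [J2]
   sees every translate of [psi] as [J2 psi]. *)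
Lemma haar_compare J1 J2 f : haar_functional mul J1 -> haar_functional mul J2 ->
  Ccp f -> exists2 C, 0 <= C & forall e, 0 < e -> exists2 V, nbhs one V &
    forall psi, bumpish psi -> supported V psi -> (forall x, psi (inv x) = psi x) ->
    `|J2 f * J1 psi - J1 f * J2 psi| <= e * C * J1 psi.
Proof.
move=> hJ1 hJ2 Cf; have [_ J1Z J1p J1L _] := hJ1; have [_ J2Z J2p J2L _] := hJ2.
have [L cL fL] := Cf.1.2.
have [U] := lcQ (x := one) I; rewrite withinET => U1 [cU _].
have [U0 U01 U0U] : exists2 U0, nbhs one U0 & forall v w, U0 v -> U0 w -> U (inv w ∙ v).
  have [W W1 WU] := near_divr tgQ U1.
  exists [set v | W (inv v)]; first exact: near_inv1 tgQ _ W1.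
  by move=> v w Wv Ww; have := WU _ _ Ww Wv; rewrite (tgE tgQ).
(* For [x] outside this compact enlargement of [L] the integrand estimated below vanishes, so the
   bound may carry the compactly supported factor [k x]. *)
pose M := [set x | exists2 y, L y & U (inv y ∙ x)].
have cM : compact M.
  have -> : M = (fun z : Q * Q => z.1 ∙ z.2) @` (L `*` U).
    apply/seteqP; split => [x [y Ly Uyx]|_ [[y u] /= [Ly Uu] <-]].
      by exists (y, inv y ∙ x) => //=; rewrite !(tgE tgQ).
    by exists y => //; rewrite !(tgE tgQ).
  apply: continuous_compact; last exact: compact_setX.
  by apply: continuous_subspaceT; case: tgQ.
have [k Ck kM] := Ccp_majorant R tgQ lcQ hQ cM.
(* The pointwise bound below integrates under [J1] to [d * (1 + J1 f) * k x] with [d = e * J1 psi];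
   applying [J2] in [x] yields this constant. *)
exists (J2 k * (1 + J1 f)); first by rewrite mulr_ge0 ?J2p ?addr_ge0 ?J1p.
move=> e e0.
pose V := (U0 `&` [set v | U0 (inv v)]) `&` [set v | forall x, `|f (x ∙ v) - f x| < e].
exists V.
  apply: filterI; last exact: (Cc_unifR tgQ Cf.1 e0).
  by apply: filterI => //; exact: near_inv1 tgQ _ U01.
move=> psi bpsi Vpsi psiV; have [[Cpsi psi0] psi1] := bpsi.
have Jpsi := haar_gt0 hJ1 bpsi.
pose d := e * J1 psi; have d0 : 0 < d by rewrite mulr_gt0.
have U0one : U0 one by exact: nbhs_singleton.
have nW : nbhs one (U0 `&` [set v | forall x, `|psi (inv v ∙ x) - psi x| < d]).
  by apply: filterI => //; exact: near_inv1 tgQ _ (Cc_unifL tgQ Cpsi d0).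
have [s [b [cb b0 bW bL]]] := partition_of_unity cL nW.
have Cfb p : Cc (fun y => f y * b p y) by apply: Cc_mul; [exact: cb|exact: Cf.1].
have fE y : f y = \sum_(p <- s) f y * b p y.
  rewrite -mulr_sumr; have [Ly|/fL->] := pselect (L y); last by rewrite mul0r.
  by rewrite bL// mulr1.
(* A Riemann sum for the [J1]-integral in [y] of [f y * psi (inv y ∙ x)], with [y] in [psi] sampled
   at the centres [p.2]. *)
pose G x := \sum_(p <- s) J1 (fun y => f y * b p y) * psi (inv p.2 ∙ x).
have CG : Cc G by apply: Cc_sum => p; apply: Cc_scale; exact: (Cc_transL tgQ).
have J1f : J1 f = \sum_(p <- s) J1 (fun y => f y * b p y).
  by rewrite -haar_sum//; congr J1; apply/funext => y; rewrite -fE.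
have J2G : J2 G = J1 f * J2 psi.
  rewrite /G haar_sum//; last by move=> p; apply: Cc_scale; exact: (Cc_transL tgQ).
  rewrite J1f mulr_suml; apply: eq_bigr => p _.
  by rewrite (J2Z _ (fun x => psi (inv p.2 ∙ x)) (Cc_transL tgQ _ Cpsi)) J2L.
have CfJ : Cc (fun x => J1 psi * f x) by exact: Cc_scale Cf.1.
rewrite [J2 f * _]mulrC -(J2Z (J1 psi) f Cf.1).
rewrite -J2G -haar_sub//.
rewrite (_ : e * _ * _ = J2 (fun x => (d * (1 + J1 f)) * k x)); last first.
  by rewrite J2Z ?/d; [ring|exact: Ck.1].
apply: haar_abs => //; first exact: Cc_sub.
  by apply: Cc_scale; exact: Ck.1.
move=> x.
have Cpsix : Cc (fun y => psi (inv x ∙ y)) by exact: (Cc_transL tgQ).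
have CS : Cc (fun y => \sum_(p <- s) psi (inv p.2 ∙ x) * (f y * b p y)).
  by apply: Cc_sum => p; exact: Cc_scale.
have -> : J1 psi * f x - G x = J1 (fun y => f x * psi (inv x ∙ y)
    - \sum_(p <- s) psi (inv p.2 ∙ x) * (f y * b p y)).
  rewrite (haar_sub (f := fun y => f x * psi (inv x ∙ y)) hJ1 (Cc_scale _ Cpsix) CS).
  rewrite (J1Z _ (fun y => psi (inv x ∙ y)) Cpsix) J1L// mulrC; congr (_ - _).
  rewrite haar_sum//; last by move=> p; exact: Cc_scale.
  by apply: eq_bigr => p _; rewrite J1Z// mulrC.
have -> : d * (1 + J1 f) * k x = J1 (fun y => k x * e * psi (inv x ∙ y) + k x * d * f y).
  case: hJ1 => J1D _ _ _ _.
  rewrite (J1D (fun y => k x * e * psi (inv x ∙ y)) (fun y => k x * d * f y)); try exact: Cc_scale Cf.1; last exact: Cc_scale.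
  rewrite (J1Z _ (fun y => psi (inv x ∙ y)) Cpsix) J1L// J1Z ?/d; [ring|exact: Cf.1].
apply: haar_abs => //.
- by apply: Cc_sub => //; exact: Cc_scale.
- by apply: Cc_add; apply: Cc_scale => //; exact: Cf.1.
(* The first summand is small because [psi] forces [x] close to [y] and [f] is uniformly continuous;
   the second because [b p] forces [y] close to [p.2] and [psi] is uniformly continuous. *)
move=> y; rewrite (_ : _ - _ = (f x - f y) * psi (inv x ∙ y)
    + \sum_(p <- s) f y * b p y * (psi (inv x ∙ y) - psi (inv p.2 ∙ x))); last first.
  under [in RHS]eq_bigr do rewrite mulrBr [X in _ - X]mulrC.
  by rewrite big_split /= sumrN -mulr_suml -fE; ring.
have k0 : 0 <= k x by exact: Ck.2.
apply: le_trans (ler_normD _ _) _; apply: lerD.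
  rewrite normrM (ger0_norm (psi0 _)).
  have [->|pxy] := eqVneq (psi (inv x ∙ y)) 0; first by rewrite !mulr0.
  rewrite ler_wpM2r//.
  have [[_ Uv] Vv] := Vpsi _ pxy.
  have := Vv x; rewrite !(tgE tgQ) distrC => fxy.
  have [Mx|nMx] := pselect (M x).
    by have := kM x Mx; have := ltW e0; nra.
  have fx : f x = 0.
    by apply: fL => Lx; apply: nMx; exists x => //; rewrite (tgE tgQ); exact: (nbhs_singleton U1).
  have fy : f y = 0.
    apply: fL => Ly; apply: nMx; exists y => //.
    by have := U0U _ _ Uv U0one; rewrite /= !(tgE tgQ).
  by rewrite fx fy subrr normr0 mulr_ge0// ltW.
apply: le_trans (ler_norm_sum _ _ _) _.
rewrite {2}(fE y) mulr_sumr !big_seq; apply: ler_sum => p ps.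
have fb0 : 0 <= f y * b p y by rewrite mulr_ge0 ?b0//; exact: Cf.2.
rewrite normrM (ger0_norm fb0) mulrC.
have [->|fbn] := eqVneq (f y * b p y) 0; first by rewrite !mulr0.
rewrite ler_wpM2r//.
have [fy /bW[U0y Wy]] : f y != 0 /\ b p y != 0.
  by apply/andP; rewrite -negb_or -mulf_eq0.
have Ly : L y by apply: contrapT => /fL fy0; rewrite fy0 eqxx in fy.
have psixy : psi (inv x ∙ y) = psi (inv y ∙ x) by rewrite -psiV !(tgE tgQ).
have := Wy (inv p.2 ∙ x); rewrite !(tgE tgQ) => Wyx.
have [Mx|nMx] := pselect (M x).
  by rewrite psixy; have := kM x Mx; have := ltW d0; nra.
have p1 : psi (inv x ∙ y) = 0.
  apply/eqP; apply: contra_notT nMx => /Vpsi[[_ /=]]; rewrite !(tgE tgQ) => Uv _.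
  by exists y => //; have := U0U _ _ Uv U0one; rewrite !(tgE tgQ).
have p2 : psi (inv p.2 ∙ x) = 0.
  apply/eqP; apply: contra_notT nMx => /Vpsi[[Uv _] _].
  by exists y => //; have := U0U _ _ Uv U0y; rewrite !(tgE tgQ).
by rewrite p1 p2 subrr normr0 mulr_ge0// ltW.
Qed.

(** With one small symmetric [psi], [haar_compare] relates both [f] and [g] to the same ratio
    [J2 psi / J1 psi]; eliminating [J2 psi] leaves an error tending to 0. The cross-multiplied form
    also covers vanishing integrals. *)
Lemma haar_unique J1 J2 f g : haar_functional mul J1 -> haar_functional mul J2 ->
  Ccp f -> Ccp g -> J2 f * J1 g = J1 f * J2 g.
Proof.
move=> hJ1 hJ2 Cf Cg.
have [C C0 HC] := haar_compare hJ1 hJ2 Cf.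
have [D D0 HD] := haar_compare hJ1 hJ2 Cg.
have [_ _ J1p _ _] := hJ1.
have Jf := J1p _ Cf; have Jg := J1p _ Cg.
apply/eqP; rewrite -subr_eq0 -normr_le0.
apply: (@ler_addgt_mul _ _ _ (C * J1 g + D * J1 f)).
  by rewrite addr_ge0// mulr_ge0.
move=> e e0; rewrite add0r.
have [V V1 HV] := HC e e0; have [W W1 HW] := HD e e0.
have [psi [bpsi Vpsi psiV]] := bumpish_sym_exists (filterI V1 W1).
have hf := HV psi bpsi (fun x px => (Vpsi x px).1) psiV.
have hg := HW psi bpsi (fun x px => (Vpsi x px).2) psiV.
have Jpsi := haar_gt0 hJ1 bpsi.
rewrite -(ler_pM2r Jpsi) -{1}(gtr0_norm Jpsi) -normrM.
rewrite (_ : _ * J1 psi = (J2 f * J1 psi - J1 f * J2 psi) * J1 g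
   - (J2 g * J1 psi - J1 g * J2 psi) * J1 f); last by ring.
apply: le_trans (ler_normB _ _) _; rewrite !normrM (ger0_norm Jf) (ger0_norm Jg).
rewrite (_ : e * _ * _ = e * C * J1 psi * J1 g + e * D * J1 psi * J1 f); last by ring.
by apply: lerD; rewrite ler_wpM2r.
Qed.

End HaarUniqueness.

(** * The invariant mean on the quotient by a cocompact discrete subgroup *)

Section Lattice.
Variables (R : realType) (Q : topologicalType).
Variables (mul : Q -> Q -> Q) (inv : Q -> Q) (one : Q) (Lam : set Q).
Hypothesis tgQ : topological_group mul inv one.
Hypothesis lcQ : locally_compact [set: Q].
Hypothesis hQ : hausdorff_space Q.
Hypothesis sgLam : subgroup mul inv one Lam.
Hypothesis dsLam : discrete_subset Lam.
Implicit Types (f g : Q -> R).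
Local Notation "x ∙ y" := (mul x y) (at level 40, left associativity).

Lemma subgroup1 : Lam one. Proof. by case: sgLam. Qed.

Lemma subgroupV x : Lam x -> Lam (inv x).
Proof.
move=> Lx; have [L1 LM] := sgLam.
by have := LM _ _ L1 Lx; rewrite (tgE tgQ).
Qed.

Lemma subgroupM x y : Lam x -> Lam y -> Lam (x ∙ y).
Proof.
move=> Lx /subgroupV Ly; have [_ LM] := sgLam.
by have := LM _ _ Lx Ly; rewrite (tgE tgQ).
Qed.

(** Take [W] with all quotients [x ∙ inv y] in a neighbourhood of [one] that contains no other point
    of [Lam]. *)
Lemma discrete_subgroup_separated : exists2 W, nbhs one W &
  forall x y, W x -> W y -> Lam (x ∙ inv y) -> x = y.
Proof.
have [U [oU U1 UL]] := dsLam subgroup1.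
have [|W W1 WU] := near_divr tgQ (U := U); first exact: open_nbhs_nbhs.
exists W => // x y Wx Wy Lxy.
have : (U `&` Lam) (x ∙ inv y) by split=> //; exact: WU.
by rewrite UL /= => xy; rewrite -(tg_mulx1 tgQ x) -(tg_mulV tgQ y) -(tg_mulA tgQ) xy (tgE tgQ).
Qed.

(** Every point of [Q], in [Lam] or not, has a neighbourhood containing at most one element of
    [Lam]. *)
Lemma discrete_subgroup_compact K : compact K -> finite_set (Lam `&` K).
Proof.
move=> cK; apply: (compact_ind (P := fun A => finite_set (Lam `&` A))) => //.
- by rewrite setI0; exact: finite_set0.
- by move=> A B fA fB; rewrite setIUr finite_setU.
- by move=> A B AB; apply: sub_finite_set; exact: setIS.
move=> x _; have [W W1 WL] := discrete_subgroup_separated.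
exists [set y | W (inv y ∙ x)].
  have : inv y ∙ x @[y --> x] --> one.
    rewrite -(tg_mulV tgQ x); apply: (tg_cvgM tgQ); last exact: cvg_cst.
    exact: (tg_continuousV tgQ).
  by apply.
have [[l [Ll Wl]]|nL] := pselect (exists l, Lam l /\ W (inv l ∙ x)).
  apply: (sub_finite_set _ (finite_set1 l)) => m [Lm Wm] /=.
  have : inv m ∙ x = inv l ∙ x.
    by apply: WL => //; rewrite !(tgE tgQ); apply: subgroupM => //; exact: subgroupV.
  move=> /(congr1 (fun z => z ∙ inv x)); rewrite !(tgE tgQ) => /(congr1 inv).
  by rewrite !(tgE tgQ).
apply: (sub_finite_set _ (@finite_set0 Q)) => m [Lm Wm] /=.
by apply: nL; exists m.
Qed.

(** Such an [l] lies in the compact set of quotients [z ∙ inv x] with [z] in [L] and [x] in [K]. The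
    type [{classic Q}] supplies the equality test for list membership. *)
Lemma discrete_subgroup_meet K L : compact K -> compact L ->
  exists2 r : seq {classic Q}, uniq r & forall l : {classic Q},
    (l \in r) <-> (Lam l /\ exists2 x, K x & L (l ∙ x)).
Proof.
move=> cK cL; pose M := (fun z : Q * Q => z.1 ∙ inv z.2) @` (L `*` K).
have cM : compact M.
  apply: continuous_compact; last exact: compact_setX.
  apply: continuous_subspaceT => z; apply: (tg_cvgM tgQ); first exact: cvg_fst.
  by apply: (tg_cvgV tgQ); exact: cvg_snd.
have := discrete_subgroup_compact cM.
pose A : set {classic Q} := [set l | Lam l /\ exists2 x, K x & L (l ∙ x)].
move=> /(@sub_finite_set {classic Q} A) fA.
have /finite_seqP[r AX] : finite_set A.
  apply: fA => l [Ll [x Kx Lx]]; split => //.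
  by exists (l ∙ x, x) => //=; rewrite !(tgE tgQ).
exists (undup r) => [|l]; first exact: undup_uniq.
rewrite mem_undup; have [AX1 AX2] : A l <-> [set` r] l by rewrite AX.
by split => [/AX2|/AX1].
Qed.

(** Periodisation. The sum is 0 by convention when infinitely many terms are nonzero, which never
    happens for [f] in [Cc]. *)
Definition per f (x : Q) : R :=
  \sum_(l \in (Lam : set {classic Q})) f ((l : Q) ∙ x).

Lemma perE f x (r : seq {classic Q}) : uniq r ->
  (forall l : {classic Q}, l \in r -> Lam l) ->
  (forall l : {classic Q}, Lam l -> l \notin r -> f (l ∙ x) = 0) ->
  per f x = \sum_(l <- r) f ((l : Q) ∙ x).
Proof.
move=> ur rL f0; rewrite /per (fsbigE r)//.
rewrite big_seq_cond [RHS]big_seq; apply: eq_bigl => l.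
by case: (boolP (l \in r)) => //= /rL Ll; apply/asboolP.
Qed.

(** Only finitely many [l] carry a point of a compact neighbourhood of [x] into the support of [f],
    so one list serves all nearby points. *)
Lemma per_local f (x : Q) : Cc f -> exists r : seq {classic Q},
  (forall l : {classic Q}, l \in r -> Lam l) /\
  \forall y \near x, per f y = \sum_(l <- r) f ((l : Q) ∙ y).
Proof.
move=> [cf [L cL fL]].
have [U] := lcQ (x := x) I; rewrite withinET => Ux [cU _].
have [r ur rP] := discrete_subgroup_meet cU cL.
exists r; split => [l /rP[]//|]; apply: filterS Ux => y Uy.
apply: perE => // [l /rP[]//|l Ll nlr].
by apply: fL => Ly; move/negP: nlr; apply; apply/rP; split => //; exists y.
Qed.

Lemma per_continuous f : Cc f -> continuous (per f).
Proof.
move=> Cf x; have [r [_ rP]] := per_local x Cf.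
have rx : per f x = \sum_(l <- r) f ((l : Q) ∙ x) := nbhs_singleton rP.
have : (fun y : Q => \sum_(l <- r) f ((l : Q) ∙ y)) @ x -->
    \sum_(l <- r) f ((l : Q) ∙ x).
  exact: (Cc_sum r (fun l : {classic Q} => Cc_transL tgQ l Cf)).1.
rewrite /continuous_at rx; apply: cvg_trans; apply: near_eq_cvg.
by apply: filterS rP => y ->.
Qed.

Lemma per_ge0 f x : (forall x, 0 <= f x) -> 0 <= per f x.
Proof. by move=> f0; apply: fsumr_ge0. Qed.

Lemma per_gt0 f x : Ccp f -> (exists2 l, Lam l & 0 < f (l ∙ x)) -> 0 < per f x.
Proof.
move=> [Cf f0] [l Ll fl]; have [L cL fL] := Cf.2.
have [r ur rP] := discrete_subgroup_meet (@compact_set1 _ x) cL.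
have lr : (l : {classic Q}) \in r.
  apply/rP; split => //; exists x => //; apply: contrapT => /fL fl0.
  by rewrite fl0 ltxx in fl.
rewrite (perE (r := r))//.
- rewrite (bigD1_seq (l : {classic Q}))//=.
  by apply: ltr_wpDr => //; exact: sumr_ge0.
- by move=> m /rP[].
- by move=> m Lm nmr; apply: fL => Lmx; move/negP: nmr; apply; apply/rP; split => //; exists x.
Qed.

Lemma per_inv f l x : Lam l -> per f (l ∙ x) = per f x.
Proof.
move=> Ll; rewrite /per.
rewrite [RHS](reindex_fsbig (fun m : {classic Q} => (m : Q) ∙ l : {classic Q}) (Lam : set {classic Q}))/=.
  by apply: eq_fsbigr => m _; rewrite (tgE tgQ).
split.
- by move=> m Lm /=; exact: subgroupM.
- move=> m n _ _ /= /(congr1 (fun z : Q => z ∙ inv l)).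
  by rewrite !(tgE tgQ).
- move=> m Lm /=; exists (m ∙ inv l : Q); last by rewrite !(tgE tgQ).
  by apply: subgroupM => //; exact: subgroupV.
Qed.

Lemma per_transR f y x : per (fun z => f (z ∙ y)) x = per f (x ∙ y).
Proof. by apply: eq_fsbigr => l _; rewrite (tgE tgQ). Qed.

(** These are the continuous functions on the quotient by [Lam], represented by their lifts to
    [Q]. *)
Definition lam_inv f := continuous f /\ forall l x, Lam l -> f (l ∙ x) = f x.

(* Unfolding: both sides are the sum over [l] in [Lam] of the integrals of
   [x |-> f x * u x * v (l x)]. *)
Lemma haar_per_swap J u v f : haar_functional mul J -> Cc u -> Cc v -> lam_inv f ->
  J (fun x => u x * (f x * per v x)) = J (fun x => v x * (f x * per u x)).
Proof.
move=> hJ Cu Cv [cf fL].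
have [K cK uK] := Cu.2; have [L cL vL] := Cv.2.
have [r ur rP] := discrete_subgroup_meet cK cL.
have rL (l : {classic Q}) : l \in r -> Lam l by move=> /rP[].
have [_ _ _ JL _] := hJ.
have -> : (fun x => u x * (f x * per v x)) = (fun x => \sum_(l <- r) (u x * f x) * v ((l : Q) ∙ x)).
  apply/funext => x; rewrite -mulr_sumr -mulrA.
  have [Kx|/uK->] := pselect (K x); last by rewrite !mul0r.
  rewrite (perE (r := r))// => l Ll nlr; apply: vL => Lx.
  by move/negP: nlr; apply; apply/rP; split => //; exists x.
have -> : (fun x => v x * (f x * per u x)) = (fun x => \sum_(l <- r) (v x * f x) * u (inv l ∙ x)).
  apply/funext => x; rewrite -mulr_sumr -mulrA.
  have [Lx|/vL->] := pselect (L x); last by rewrite !mul0r.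
  congr (_ * (_ * _)).
  rewrite (perE (r := [seq (inv l : {classic Q}) | l : {classic Q} <- r])).
  - by rewrite big_map.
  - rewrite map_inj_uniq// => l m /= /(congr1 inv).
    by rewrite !(tgE tgQ).
  - by move=> _ /mapP[l /rL Ll ->]; exact: subgroupV.
  - move=> l Ll nlr; apply: uK => Kx; move/negP: nlr; apply.
    apply/mapP; exists (inv l : {classic Q}); last by rewrite /= (tgE tgQ).
    apply/rP; split; first exact: subgroupV.
    by exists (l ∙ x) => //; rewrite !(tgE tgQ).
have Cuf : Cc (fun x => u x * f x) by exact: Cc_mul.
have Cvf : Cc (fun x => v x * f x) by exact: Cc_mul.
rewrite (@haar_sum R Q mul J _ r (fun (l : {classic Q}) x => u x * f x * v ((l : Q) ∙ x)) hJ); last first.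
  by move=> l; apply: Cc_mul => //; exact: (Cc_transL tgQ l Cv).1.
rewrite (@haar_sum R Q mul J _ r (fun (l : {classic Q}) x => v x * f x * u (inv (l : Q) ∙ x)) hJ); last first.
  by move=> l; apply: Cc_mul => //; exact: (Cc_transL tgQ (inv l) Cu).1.
rewrite !big_seq; apply: eq_bigr => l /rL Ll.
rewrite -(JL l (fun x => v x * f x * u (inv l ∙ x))); last by apply: Cc_mul => //; exact: (Cc_transL tgQ (inv l) Cu).1.
by congr J; apply/funext => x; rewrite fL// !(tgE tgQ); ring.
Qed.

Hypothesis cocompact : exists2 K, compact K & forall x, exists2 l, Lam l & K (l ∙ x).

(** Integrating against [k / per k], whose periodisation is 1, amounts to integrating over the
    quotient; the result is divided by the total mass [I (kk one_)]. *)
Lemma invariant_mean : exists J : (Q -> R) -> R,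
  [/\ forall f g, lam_inv f -> lam_inv g -> J (fun x => f x + g x) = J f + J g,
      forall c f, lam_inv f -> J (fun x => c * f x) = c * J f,
      forall f, lam_inv f -> (forall x, 0 <= f x) -> 0 <= J f,
      J (fun=> 1) = 1 &
      forall f y, lam_inv f -> J (fun x => f (x ∙ y)) = J f].
Proof.
have [K cK Kcov] := cocompact.
have [k Ck kK] := Ccp_majorant R tgQ lcQ hQ (compactU cK (compact_set1 (x := one))).
have pk0 x : 0 < per k x.
  apply: per_gt0 => //; have [l Ll Klx] := Kcov x; exists l => //.
  by apply: lt_le_trans (kK _ (or_introl Klx)).
have cpk : continuous (per k) by exact: per_continuous Ck.1.
have cV (h : Q -> R) : continuous h -> (forall x, 0 < h x) -> continuous (fun x => (h x)^-1).
  by move=> ch h0 x; apply: cvgV; [rewrite gt_eqF|exact: ch].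
have [I hI] := haar_exists R tgQ lcQ hQ.
have [ID IZ Ip IL _] := hI.
pose kk f x := k x * (f x * (per k x)^-1).
have Ckk f : continuous f -> Cc (kk f).
  move=> cf; apply: Cc_mul Ck.1 => x; apply: cvgM; first exact: cf.
  exact: cV.
pose one_ : Q -> R := fun=> 1.
have c1 : continuous one_ by exact: cst_continuous.
have Cpk1 : Ccp (kk one_).
  split; first exact: Ckk.
  by move=> x; rewrite /kk mul1r mulr_ge0// ?invr_ge0 ?(ltW (pk0 _))//; exact: Ck.2.
have I1 : 0 < I (kk one_).
  apply: (haar_gt0 tgQ hI); split => //; rewrite /kk mul1r divr_gt0//.
  by apply: lt_le_trans (kK _ (or_intror erefl)).
(* The weight may be replaced by its right translate: apply [haar_per_swap] to that translate of [k]
   and to [k], with [f] divided by both periodisations. *)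
have swap (g : Q) f : lam_inv f ->
    I (fun x => k (x ∙ g) * (f x * (per k (x ∙ g))^-1)) = I (kk f).
  move=> [cf fL]; pose u x := k (x ∙ g).
  have Cu : Cc u by exact: (Cc_transR tgQ g Ck.1).
  have pu x : per u x = per k (x ∙ g) by exact: per_transR.
  have pu0 x : 0 < per u x by rewrite pu.
  have := @haar_per_swap I u k (fun x => f x * ((per k x)^-1 * (per u x)^-1)) hI Cu Ck.1.
  have -> : (fun x => u x * (f x * ((per k x)^-1 * (per u x)^-1) * per k x)) =
      (fun x => k (x ∙ g) * (f x * (per k (x ∙ g))^-1)).
    apply/funext => x; rewrite /u pu; congr (_ * _).
    by rewrite -mulrA; congr (_ * _); rewrite mulrAC mulVf ?mul1r// gt_eqF.
  have -> : (fun x => k x * (f x * ((per k x)^-1 * (per u x)^-1) * per u x)) = kk f.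
    apply/funext => x; rewrite /kk -mulrA; congr (_ * (_ * _)).
    by rewrite divfK// gt_eqF.
  apply; split=> [x|l x Ll]; last by rewrite fL// !per_inv.
  apply: cvgM; first exact: cf.
  by apply: cvgM; apply: cV => //; exact: per_continuous.
have hIg (g : Q) : haar_functional mul (fun f => I (fun x => f (x ∙ g))).
  split.
  - by move=> f h Cf Ch; rewrite ID//; exact: (Cc_transR tgQ).
  - by move=> c f Cf; rewrite (IZ c (fun x => f (x ∙ g)))//; exact: (Cc_transR tgQ).
  - by move=> f [Cf f0]; apply: Ip; split=> //; exact: (Cc_transR tgQ).
  - move=> y f Cf; rewrite -(IL y (fun x => f (x ∙ g))); last exact: (Cc_transR tgQ).
    by congr I; apply/funext => x; rewrite (tgE tgQ).
  - exists (fun x => kk one_ (x ∙ inv g)).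
      by split; [exact: (Cc_transR tgQ _ Cpk1.1)|move=> x; exact: Cpk1.2].
    rewrite (_ : (fun x => _) = kk one_) ?gt_eqF//.
    by apply/funext => x; rewrite !(tgE tgQ).
(* By uniqueness right translation rescales [I], and by [swap] it fixes the positive number
   [I (kk one_)]; so the scale is 1. *)
have unimodp (g : Q) f : Ccp f -> I (fun x => f (x ∙ g)) = I f.
  move=> Cf; have := haar_unique tgQ lcQ hQ hI (hIg g) Cf Cpk1.
  rewrite /= (_ : I (fun x => kk one_ (x ∙ g)) = I (kk one_)).
    by move/mulIf; apply; rewrite gt_eqF.
  rewrite -[RHS](swap g); first by [].
  by split.
have unimod (g : Q) f : Cc f -> I (fun x => f (x ∙ g)) = I f.
  move=> Cf; have Ca : Ccp (fun x => `|f x|) by split=> //; exact: Cc_abs.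
  have Cn : Ccp (fun x => `|f x| + f x).
    split; first by apply: Cc_add => //; exact: Ca.1.
    by move=> x; have := ler_norm (- f x); rewrite normrN; lra.
  have h1 := unimodp g _ Ca; have h2 := unimodp g _ Cn.
  have h3 := ID _ _ Ca.1 Cf.
  have := ID _ _ (Cc_transR tgQ g Ca.1) (Cc_transR tgQ g Cf).
  by move: h1 h2 => /= -> ->; rewrite h3; lra.
exists (fun f => I (kk f) / I (kk one_)); split.
- move=> f g [cf _] [cg _]; rewrite -mulrDl; congr (_ / _).
  rewrite -ID; [congr I|exact: Ckk|exact: Ckk].
  by apply/funext => x; rewrite /kk; ring.
- move=> c f [cf _]; rewrite mulrA; congr (_ / _).
  rewrite -IZ; [congr I|exact: Ckk].
  by apply/funext => x; rewrite /kk; ring.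
- move=> f [cf _] f0; rewrite divr_ge0 ?(ltW I1)//; apply: Ip.
  split; first exact: Ckk.
  by move=> x; rewrite /kk !mulr_ge0// ?invr_ge0 ?(ltW (pk0 _))//; exact: Ck.2.
- by rewrite divff// gt_eqF.
- move=> f y [cf fL]; congr (_ / _).
  (* Function and weight are translated together, then [swap] restores the original weight. *)
  rewrite -(unimod y (kk f)); last exact: Ckk.
  rewrite -(swap y (fun x => f (x ∙ y))) //; split.
    by move=> x; apply: continuous_comp; [exact: (tg_continuousR tgQ)|exact: cf].
  by move=> l x Ll; rewrite (tgE tgQ) fL.
Qed.
End Lattice.

(** * Monotone coupling of partitions of the unit interval *)

Section MonotoneCoupling.
Variables (R : realType) (n : nat).
Implicit Types (a c e : nat -> R).

Definition len (lo hi : R) : R := Num.max 0 (hi - lo).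

(* [overlap2 a c i j] is the length of the intersection of [[a i, a i.+1[] and
   [[c j, c j.+1[]; [overlap3] is its analogue for three subdivisions. *)
Definition overlap2 a c i j :=
  len (Num.max (a i) (c j)) (Num.min (a i.+1) (c j.+1)).

Definition overlap3 a c e i j k :=
  len (Num.max (Num.max (a i) (c j)) (e k))
      (Num.min (Num.min (a i.+1) (c j.+1)) (e k.+1)).

Definition cuts a := [/\ a 0%N = 0, a n = 1 & forall k, a k <= a k.+1].

Lemma len_ge0 lo hi : 0 <= len lo hi.
Proof. by rewrite /len le_max lexx. Qed.

Lemma len_sub lo hi : lo <= hi -> len lo hi = hi - lo.
Proof. by move=> lohi; rewrite /len (max_idPr _)// subr_ge0. Qed.

Lemma len_eq0 lo hi : hi <= lo -> len lo hi = 0.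
Proof. by move=> hilo; rewrite /len (max_idPl _)// subr_le0. Qed.

Lemma len_split lo hi u v : u <= v ->
  len lo (Num.min hi u) + len (Num.max lo u) (Num.min hi v) =
  len lo (Num.min hi v).
Proof.
move=> uv; have [hiu|uhi] := leP hi u.
  rewrite (len_eq0 (lo := Num.max lo u)) ?addr0.
    by rewrite (min_idPl (le_trans hiu uv)).
  by rewrite ge_min le_max hiu orbT.
have uhv : u <= Num.min hi v by rewrite le_min uv ltW.
have [lou|ulo] := leP lo u.
  by rewrite !len_sub//; [ring|exact: le_trans uhv].
by rewrite (len_eq0 (ltW ulo)) add0r.
Qed.

Lemma sum_len e m lo hi : (forall k, e k <= e k.+1) -> e 0%N <= lo ->
  \sum_(k < m) len (Num.max lo (e k)) (Num.min hi (e k.+1)) =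
  len lo (Num.min hi (e m)).
Proof.
move=> eS e0; elim: m => [|m IH].
  by rewrite big_ord0 len_eq0// ge_min e0 orbT.
by rewrite big_ord_recr /= IH len_split.
Qed.

Lemma cuts_ge0 a k : cuts a -> 0 <= a k.
Proof. by move=> [a0 _ aS]; elim: k => [|k /le_trans]; [rewrite a0|apply]. Qed.

Lemma cuts_le1 a k : cuts a -> (k <= n)%N -> a k <= 1.
Proof.
move=> [_ <- aS]; elim: n => [|m IH]; first by rewrite leqn0 => /eqP->.
by rewrite leq_eqVlt => /predU1P[->//|/IH/le_trans]; apply.
Qed.

Lemma overlap3C12 a c e i j k : overlap3 a c e i j k = overlap3 c a e j i k.
Proof. by rewrite /overlap3 (maxC (a i)) (minC (a i.+1)). Qed.

Lemma overlap3C23 a c e i j k : overlap3 a c e i j k = overlap3 a e c i k j.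
Proof. by rewrite /overlap3 -maxA (maxC (c j)) maxA -minA (minC (c j.+1)) minA. Qed.

(** The pairwise overlaps are the marginals of the triple ones, so three subdivisions can be coupled
    consistently. *)
Lemma sum_overlap3 a c e i j : cuts a -> cuts e -> (i < n)%N ->
  \sum_(k < n) overlap3 a c e i j k = overlap2 a c i j.
Proof.
move=> ca ce ltin; have [e0 e1 eS] := ce.
rewrite /overlap3 sum_len//; last by rewrite e0 le_max cuts_ge0.
by rewrite e1 /overlap2 (min_idPl _)// ge_min cuts_le1.
Qed.

Lemma sum_overlap2 a c i : cuts a -> cuts c -> (i < n)%N ->
  \sum_(j < n) overlap2 a c i j = a i.+1 - a i.
Proof.
move=> ca [c0 c1 cS] ltin; rewrite /overlap2 sum_len//; last by rewrite c0 cuts_ge0.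
rewrite c1 (min_idPl _) ?cuts_le1// /len (max_idPr _)// subr_ge0.
by case: ca => _ _ aS.
Qed.

Lemma sum_cuts a : cuts a -> \sum_(i < n) (a i.+1 - a i) = 1.
Proof.
move=> [a0 a1 _]; rewrite -(big_mkord xpredT (fun i => a i.+1 - a i)).
by rewrite telescope_sumr// a0 a1 subr0.
Qed.

(** Equal subdivisions are coupled along the diagonal. A product coupling would also charge pairs of
    different charts, and the average would no longer restrict to [phi] on [G]. *)
Lemma overlap2_diag a i j : (forall k, a k <= a k.+1) ->
  overlap2 a a i j = if i == j then a i.+1 - a i else 0.
Proof.
move=> aS; have mono : {homo a : k m / (k <= m)%N >-> k <= m}.
  by apply: homo_leq aS => //; exact: le_trans.
rewrite /overlap2; case: (ltngtP i j) => [/mono ij|/mono ji|->].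
- by rewrite len_eq0// ge_min le_max ij !orbT.
- by rewrite len_eq0// ge_min !le_max ji !orbT.
- by rewrite maxxx minxx len_sub.
Qed.

Lemma overlap2_neq0 a c i j : overlap2 a c i j != 0 -> a i < a i.+1 /\ c j < c j.+1.
Proof.
move=> w0; have : 0 < overlap2 a c i j by rewrite lt_def w0 len_ge0.
rewrite /overlap2 /len lt_max ltxx /= subr_gt0 gt_max !lt_min.
by case/andP=> /andP[-> _] /andP[_ ->].
Qed.

Lemma overlap3_gt0 a c e i j k : 0 < overlap3 a c e i j k ->
  [/\ a i < a i.+1, c j < c j.+1 & e k < e k.+1].
Proof.
rewrite /overlap3 /len lt_max ltxx /= subr_gt0 !gt_max !lt_min.
by case/andP=> /andP[/andP[/andP[-> _] _] /andP[/andP[_ ->] _]] /andP[_ ->].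
Qed.

(** All three double sums become sums over triples with the weights [overlap3], nonnegative and of
    total mass 1. Triples with an empty interval have weight 0, so the bound is asked only of the
    others. *)
Lemma coupling_bound a c e (x y z : nat -> nat -> R) C :
  cuts a -> cuts c -> cuts e ->
  (forall i j k, a i < a i.+1 -> c j < c j.+1 -> e k < e k.+1 ->
     `|x i k - y i j - z j k| <= C) ->
  `| \sum_(i < n) \sum_(k < n) overlap2 a e i k * x i k
     - \sum_(i < n) \sum_(j < n) overlap2 a c i j * y i j
     - \sum_(j < n) \sum_(k < n) overlap2 c e j k * z j k | <= C.
Proof.
move=> ca cc ce H; pose w := overlap3 a c e.
have w0 i j k : 0 <= w i j k by exact: len_ge0.
have -> : \sum_(i < n) \sum_(k < n) overlap2 a e i k * x i k =
    \sum_(i < n) \sum_(j < n) \sum_(k < n) w i j k * x i k.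
  apply: eq_bigr => i _; rewrite [RHS]exchange_big /=; apply: eq_bigr => k _.
  rewrite -mulr_suml; congr (_ * _); rewrite -(@sum_overlap3 a e c i k ca cc)//.
  by apply: eq_bigr => j _; rewrite overlap3C23.
have -> : \sum_(i < n) \sum_(j < n) overlap2 a c i j * y i j =
    \sum_(i < n) \sum_(j < n) \sum_(k < n) w i j k * y i j.
  apply: eq_bigr => i _; apply: eq_bigr => j _.
  by rewrite -mulr_suml (@sum_overlap3 a c e i j ca ce).
have -> : \sum_(j < n) \sum_(k < n) overlap2 c e j k * z j k =
    \sum_(i < n) \sum_(j < n) \sum_(k < n) w i j k * z j k.
  rewrite [RHS]exchange_big /=; apply: eq_bigr => j _.
  rewrite [RHS]exchange_big /=; apply: eq_bigr => k _.
  rewrite -mulr_suml; congr (_ * _); rewrite -(@sum_overlap3 c e a j k cc ca)//.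
  by apply: eq_bigr => i _; rewrite /w [RHS]overlap3C12 [RHS]overlap3C23.
have C1 : C = \sum_(i < n) \sum_(j < n) \sum_(k < n) w i j k * C.
  under eq_bigr => i _ do under eq_bigr => j _ do
    rewrite -mulr_suml (@sum_overlap3 a c e i j ca ce)//.
  under eq_bigr => i _ do rewrite -mulr_suml (@sum_overlap2 a c i ca cc)//.
  by rewrite -mulr_suml sum_cuts// mul1r.
rewrite [leRHS]C1 -!sumrB.
apply: le_trans (ler_norm_sum _ _ _) _; apply: ler_sum => i _.
rewrite -!sumrB; apply: le_trans (ler_norm_sum _ _ _) _; apply: ler_sum => j _.
rewrite -!sumrB; apply: le_trans (ler_norm_sum _ _ _) _; apply: ler_sum => k _.
rewrite -!mulrBr normrM (ger0_norm (w0 _ _ _)).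
have := w0 i j k; rewrite le_eqVlt => /predU1P[<-|wp]; first by rewrite !mul0r.
have [ai cj ek] := overlap3_gt0 wp.
by rewrite ler_wpM2l//; exact: H.
Qed.

Lemma overlap2_cvg (T : Type) (F : set_system T) (FF : Filter F)
    (a c : T -> nat -> R) a0 c0 i j :
  (forall k, a t k @[t --> F] --> a0 k) -> (forall k, c t k @[t --> F] --> c0 k) ->
  overlap2 (a t) (c t) i j @[t --> F] --> overlap2 a0 c0 i j.
Proof.
move=> ca cc; rewrite /overlap2 /len.
have cmax (f g : T -> R) u v : f @ F --> u -> g @ F --> v ->
    Num.max (f t) (g t) @[t --> F] --> Num.max u v.
  move=> fu gv; rewrite maxr_absE; under eq_fun do rewrite maxr_absE.
  apply: cvgM; [|exact: cvg_cst]; apply: cvgD; first exact: cvgD.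
  by apply: cvg_norm; apply: cvgB.
have cmin (f g : T -> R) u v : f @ F --> u -> g @ F --> v ->
    Num.min (f t) (g t) @[t --> F] --> Num.min u v.
  move=> fu gv; rewrite minr_absE; under eq_fun do rewrite minr_absE.
  apply: cvgM; [|exact: cvg_cst]; apply: cvgD; first exact: cvgD.
  by apply: cvgN; apply: cvg_norm; apply: cvgB.
apply: (cmax); first exact: cvg_cst.
by apply: cvgB; [exact: cmin|exact: cmax].
Qed.
End MonotoneCoupling.

(** * Equivariant local sections *)

(** A finite Baire argument: if [D i] does not contain [W], the nonempty open set [W] minus [D i] is
    covered by the remaining sets. *)
Lemma closed_cover_interior (T : topologicalType) (I : eqType) (s : seq I)
  (D : I -> set T) (W : set T) : (forall i, closed (D i)) -> open W -> W !=set0 ->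
  (forall x, W x -> exists2 i, i \in s & D i x) ->
  exists i, exists2 x : T, i \in s & nbhs x (D i).
Proof.
move=> cD; elim: s W => [|i s IH] W oW [x Wx] Wcov.
  by have [] := Wcov x Wx.
have [WD|] := pselect (W `<=` D i).
  exists i, x; first exact: mem_head.
  by apply: filterS WD _; apply: open_nbhs_nbhs.
move=> /existsNP[y /not_implyP[Wy nDy]].
have [j [z js zD]] : exists j, exists2 z : T, j \in s & nbhs z (D j).
  apply: (IH (W `&` ~` D i)).
  - by apply: openI => //; exact: closed_openC.
  - by exists y.
  - move=> z [Wz nDz]; have [j] := Wcov z Wz.
    by rewrite inE => /predU1P[->//|js] Dj; exists j.
by exists j, z => //; rewrite inE js orbT.
Qed.

Lemma cvg_sum_seq (R : realType) (T I : Type) (F : set_system T) (FF : Filter F)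
    (s : seq I) (f : I -> T -> R) (l : I -> R) :
  (forall i, f i t @[t --> F] --> l i) ->
  \sum_(i <- s) f i t @[t --> F] --> \sum_(i <- s) l i.
Proof.
move=> fl; elim: s => [|i s IH].
  by rewrite big_nil; under eq_fun do rewrite big_nil; exact: cvg_cst.
by rewrite big_cons; under eq_fun do rewrite big_cons; exact: cvgD.
Qed.

Section Atlas.
Variables (R : realType).
Variables (H : topologicalType) (mulH : H -> H -> H) (invH : H -> H) (oneH : H).
Variables (Q : topologicalType) (mul : Q -> Q -> Q) (inv : Q -> Q) (one : Q).
Variables (q : H -> Q) (Lam : set Q) (s1 : Q -> H).
Hypothesis tgH : topological_group mulH invH oneH.
Hypothesis tgQ : topological_group mul inv one.
Hypothesis hQ : hausdorff_space Q.
Hypothesis lcQ : locally_compact [set: Q].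
Hypothesis qM : group_hom mulH mul [set: H] q.
Hypothesis q_surj : forall y : Q, exists g : H, q g = y.
Hypothesis sgLam : subgroup mul inv one Lam.
Hypothesis dsLam : discrete_subset Lam.
Hypothesis s1M : group_hom mul mulH Lam s1.
Hypothesis s1K : forall l, Lam l -> q (s1 l) = l.
Local Notation "x ∙ y" := (mul x y) (at level 40, left associativity).
Local Notation "x ⋆ y" := (mulH x y) (at level 40, left associativity).

Lemma hom_mul x y : q (x ⋆ y) = q x ∙ q y. Proof. exact: qM. Qed.

Lemma hom_one : q oneH = one.
Proof.
have := hom_mul oneH oneH; rewrite (tgE tgH) => /(congr1 (mul (inv (q oneH)))).
by rewrite !(tgE tgQ).
Qed.

Lemma hom_inv x : q (invH x) = inv (q x).
Proof.
by apply/esym; apply: (tg_inv_uniq tgQ); rewrite -hom_mul (tg_mulxV tgH) hom_one.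
Qed.

Definition local_section (W : set Q) (sigma : Q -> H) :=
  forall x, W x -> {for x, continuous sigma} /\ q (sigma x) = x.

Lemma local_section_exists (C : set Q) p (D : nat -> set Q) (s2 : nat -> Q -> H) :
  compact C -> (forall x, exists2 l, Lam l & C (l ∙ x)) ->
  (forall x, C x -> exists2 i, (i < p)%N & D i x) -> (forall i, closed (D i)) ->
  (forall i, (i < p)%N -> {within D i, continuous (s2 i)}) ->
  (forall i, (i < p)%N -> forall x, D i x -> q (s2 i x) = x) ->
  exists2 W, nbhs one W & exists sigma, local_section W sigma.
Proof.
move=> cC Ccov CD cD s2c s2K.
have [U] := lcQ (x := one) I; rewrite withinET => U1 [cU _].
have [r ur rP] := discrete_subgroup_meet tgQ sgLam dsLam cU cC.
have [[l i] [x lis xD]] : exists li : {classic Q} * nat, exists2 x : Q,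
    li \in [seq (l, i) | l <- r, i <- iota 0 p] &
    nbhs x [set z | D li.2 ((li.1 : Q) ∙ z)].
  apply: (@closed_cover_interior _ _ _ _ U°); [|exact: open_interior|by exists one|].
    move=> [l i] /=; apply: (@preimage_closed _ _ (fun z : Q => (l : Q) ∙ z) (D i)) => // z _.
    exact: (tg_continuousL tgQ).
  move=> y /interior_subset Uy; have [l Ll Cl] := Ccov y.
  have [i ip Di] := CD _ Cl; exists (l : {classic Q}, i) => //.
  apply: allpairs_f; last by rewrite mem_iota.
  by apply/rP; split => //; exists y.
move: lis => /allpairsP[[l' i'] /= [lr ip [ll' ii']]]; subst l' i'.
rewrite mem_iota /= add0n in ip; rewrite /= in xD.
have yD : nbhs ((l : Q) ∙ x) (D i).
  rewrite -(tg_mulVK tgQ l x) in xD.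
  by apply: filterS (near_mulL tgQ xD) => z /=; rewrite (tgE tgQ).
set y := (l : Q) ∙ x in yD; have [g gy] := q_surj y.
(* Right translation by [y] moves the interior point to [one]; multiplying by the inverse of a lift
   [g] of [y] corrects the image under [q]. *)
exists [set w | nbhs (w ∙ y) (D i)].
  apply: (near_mulR tgQ (A := (D i)°)).
  by rewrite (tgE tgQ); exact: nbhs_interior.
exists (fun w => s2 i (w ∙ y) ⋆ invH g) => w /= wD.
have Dw : D i (w ∙ y) by exact: nbhs_singleton wD.
split; last by rewrite hom_mul hom_inv gy s2K// !(tgE tgQ).
apply: (tg_cvgM tgH); last exact: cvg_cst.
have cs2 : {for w ∙ y, continuous (s2 i)}.
  have := s2c i ip (w ∙ y); rewrite /continuous_at -(nbhs_subspace_interior wD).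
  exact.
apply: (@continuous_comp _ _ _ (fun w => w ∙ y) (s2 i) w) => //.
exact: (tg_continuousR tgQ).
Qed.

(** [chart_out] makes [r] vanish near each point outside [dom], not just at it, so that terms
    weighted by [r] are locally zero where nothing is known about [s]. *)
Record bundle_chart (dom : set Q) (r : Q -> R) (s : Q -> H) : Prop := BundleChart {
  chart_cts : continuous r;
  chart_ge0 : forall x, 0 <= r x;
  chart_inv : forall l x, Lam l -> r (l ∙ x) = r x;
  chart_out : forall x, ~ dom x -> \forall y \near x, r y = 0;
  chart_dom : forall x, dom x -> \forall y \near x, dom y;
  chart_section_cts : forall x, dom x -> {for x, continuous s};
  chart_section : forall x, dom x -> q (s x) = x;
  chart_dom_inv : forall l x, Lam l -> dom x -> dom (l ∙ x);
  chart_equiv : forall l x, Lam l -> dom x -> s (l ∙ x) = s1 l ⋆ s x }.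

(** The [Lam]-translates of a small [V] are disjoint, so the translate containing a point is locally
    constant, and [s1] spreads the section equivariantly over all of them. The weight is the
    periodisation of a bump in [V]. *)
Lemma chart_exists W sigma : nbhs one W -> local_section W sigma ->
  exists dom r s, bundle_chart dom r s /\ 0 < r one.
Proof.
move=> W1 Wsigma.
have [W0 W01 W0L] := discrete_subgroup_separated tgQ sgLam dsLam.
have : nbhs one (W `&` W0) by exact: filterI.
rewrite nbhsE => -[V [oV V1] VW].
have [h [ch h0 h1 [K cK [KV hK]]]] := bump_exists R lcQ hQ (open_nbhs_nbhs (conj oV V1)).
have Ch : Ccp h by split=> //; split=> //; exists K.
have clK : closed K by exact: compact_closed.
pose P x l := Lam l /\ V (inv l ∙ x).
have Puniq x l m : P x l -> P x m -> l = m.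
  move=> [Ll Vl] [Lm Vm].
  have : inv l ∙ x = inv m ∙ x.
    apply: W0L; [exact: (VW _ Vl).2|exact: (VW _ Vm).2|].
    by rewrite !(tgE tgQ); apply: (subgroupM tgQ sgLam) => //; exact: (subgroupV tgQ sgLam).
  move=> /(congr1 (fun z => z ∙ inv x)); rewrite !(tgE tgQ) => /(congr1 inv).
  by rewrite !(tgE tgQ).
have [lam lamP] : {lam : Q -> Q & forall x, (exists l, P x l) -> P x (lam x)}.
  apply: (@choice _ _ (fun x l => (exists l, P x l) -> P x l)) => x.
  by have [[l Pl]|nP] := pselect (exists l, P x l); [exists l|exists one].
have near_P x l : P x l -> \forall y \near x, P y l.
  move=> [Ll Vl]; have : nbhs (inv l ∙ x) V by exact: open_nbhs_nbhs.
  by move=> /(near_mulL tgQ); apply: filterS.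
have lamE x l : P x l -> lam x = l.
  by move=> Pl; apply: (Puniq x) => //; apply: lamP; exists l.
have PL x l m : Lam m -> P x l -> P (m ∙ x) (m ∙ l).
  move=> Lm [Ll Vl]; split; first exact: (subgroupM tgQ sgLam).
  by rewrite !(tgE tgQ).
exists (fun x => exists l, P x l), (per mul Lam h), (fun x => s1 (lam x) ⋆ sigma (inv (lam x) ∙ x)).
split; last first.
  apply: (per_gt0 tgQ sgLam dsLam Ch); exists one; first exact: (subgroup1 sgLam).
  by rewrite (tgE tgQ).
split.
- exact: (per_continuous tgQ lcQ sgLam dsLam Ch.1).
- by move=> x; exact: per_ge0.
- by move=> l x Ll; apply: (per_inv tgQ sgLam).
- move=> x nx; have [rr [rrL]] := per_local tgQ lcQ sgLam dsLam x Ch.1.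
  have : \forall y \near x, forall l, l \in rr -> h ((l : Q) ∙ y) = 0.
    have rrL' l : l \in rr -> \forall y \near x, h ((l : Q) ∙ y) = 0.
      move=> /rrL Ll; have : nbhs ((l : Q) ∙ x) (~` K).
        apply: open_nbhs_nbhs; split; first exact: closed_openC.
        move=> /KV Vlx; apply: nx; exists (inv l); split.
          exact: (subgroupV tgQ sgLam).
        by rewrite (tgE tgQ).
      move=> /(near_mulL tgQ); apply: filterS => y.
      exact: hK.
    elim: (rr) rrL' => [|l s IH] Hs; first exact: nearW.
    have := IH (fun m ms => Hs m (mem_behead (s := l :: s) ms)).
    apply: filterS2 (Hs l (mem_head _ _)) => y hl hs m.
    by rewrite inE => /predU1P[->|/hs].
  apply: filterS2 => y h00 ->; rewrite big_seq; apply: big1 => l; exact: h00.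
- by move=> x [l Pl]; apply: filterS (near_P x l Pl) => y Py; exists l.
- move=> x [l Pl].
  have Wx : W (inv l ∙ x) by case: Pl => _ /VW[].
  have : (fun y => s1 l ⋆ sigma (inv l ∙ y)) @ x --> s1 l ⋆ sigma (inv l ∙ x).
    apply: (tg_cvgM tgH); first exact: cvg_cst.
    apply: (@continuous_comp _ _ _ (fun w => inv l ∙ w) sigma x).
      exact: (tg_continuousL tgQ).
    exact: (Wsigma _ Wx).1.
  move=> cl.
  change ((fun y => s1 (lam y) ⋆ sigma (inv (lam y) ∙ y)) @ x -->
    s1 (lam x) ⋆ sigma (inv (lam x) ∙ x)).
  rewrite (lamE x l Pl); apply: cvg_trans cl; apply: near_eq_cvg.
  by apply: filterS (near_P x l Pl) => y Py; rewrite (lamE y l Py).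
- move=> x [l Pl]; rewrite (lamE x l Pl) hom_mul s1K; last by case: Pl.
  by rewrite (Wsigma _ _).2 ?(tgE tgQ)//; case: Pl => _ /VW[].
- by move=> l x Ll [m Pm]; exists (l ∙ m); exact: PL.
- move=> l x Ll [m Pm]; rewrite (lamE _ _ (PL x m l Ll Pm)) (lamE x m Pm).
  by rewrite s1M//; [rewrite !(tgE tgQ) (tg_mulA tgH)|case: Pm].
Qed.

(** Right translation commutes with the left action of [Lam], so a chart around [one] can be moved
    to any point. *)
Lemma chart_transR dom r s y g : q g = y -> bundle_chart dom r s ->
  bundle_chart (fun x => dom (x ∙ inv y)) (fun x => r (x ∙ inv y))
    (fun x => s (x ∙ inv y) ⋆ g).
Proof.
move=> gy [rc r0 rL rout rdom sc sq domL sL].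
split.
- by move=> x; apply: continuous_comp; [exact: (tg_continuousR tgQ)|exact: rc].
- by move=> x; exact: r0.
- by move=> l x Ll; rewrite (tgE tgQ) rL.
- by move=> x /rout/(near_mulR tgQ).
- by move=> x /rdom/(near_mulR tgQ).
- move=> x /sc scx; apply: (tg_cvgM tgH); last exact: cvg_cst.
  apply: (@continuous_comp _ _ _ (fun w => w ∙ inv y) s x) => //.
  exact: (tg_continuousR tgQ).
- by move=> x /sq sqx; rewrite hom_mul sqx gy !(tgE tgQ).
- by move=> l x Ll dx; rewrite (tgE tgQ); exact: domL.
- by move=> l x Ll dx; rewrite (tgE tgQ) sL// (tg_mulA tgH).
Qed.

(** [a x] lists the partial sums of a partition of unity: chart [i] has weight [a x i.+1 - a x i] at
    [x]. *)
Record atlas n (dom : nat -> set Q) (a : Q -> nat -> R) (s : nat -> Q -> H) : Prop := Atlas {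
  atlas_cuts : forall x, cuts n (a x);
  atlas_cts : forall k, continuous (a ^~ k);
  atlas_inv : forall l x, Lam l -> a (l ∙ x) = a x;
  atlas_out : forall i x, ~ dom i x -> \forall y \near x, a y i = a y i.+1;
  atlas_dom : forall i x, dom i x -> \forall y \near x, dom i y;
  atlas_section_cts : forall i x, dom i x -> {for x, continuous (s i)};
  atlas_section : forall i x, dom i x -> q (s i x) = x;
  atlas_equiv : forall i l x, Lam l -> dom i x -> s i (l ∙ x) = s1 l ⋆ s i x }.

(** Finitely many right translates of [r] have positive sum on [C], hence by invariance on all of
    [Q]; dividing by this sum gives the weights. *)
Lemma atlas_exists (C : set Q) dom r s : compact C ->
  (forall x, exists2 l, Lam l & C (l ∙ x)) ->
  bundle_chart dom r s -> 0 < r one -> exists n dom' a s', atlas n dom' a s'.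
Proof.
move=> cC Ccov ch r1.
have [ys ysP] : exists ys : seq Q, forall x, C x ->
    exists2 i, (i < size ys)%N & 0 < r (x ∙ inv (nth one ys i)).
  apply: (compact_ind (P := fun A => exists ys : seq Q, forall x, A x ->
    exists2 i, (i < size ys)%N & 0 < r (x ∙ inv (nth one ys i)))) => //.
  - by exists [::].
  - move=> A B [ys ysA] [zs zsB]; exists (ys ++ zs) => x [/ysA|/zsB] [i isz ri].
      exists i; first by rewrite size_cat ltn_addr.
      by rewrite nth_cat isz.
    exists (size ys + i)%N; first by rewrite size_cat ltn_add2l.
    by rewrite nth_cat ltnNge leq_addr /= addKn.
  - by move=> A B AB [ys ysB]; exists ys => x /AB/ysB.
  - move=> x _; exists [set z | 0 < r (z ∙ inv x)].
      have cr : {for x, continuous (fun z => r (z ∙ inv x))}.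
        by apply: continuous_comp; [exact: (tg_continuousR tgQ)|exact: (chart_cts ch)].
      have r1' : 0 < r (x ∙ inv x) by rewrite (tgE tgQ).
      exact: (cvgr_gt _ cr _ r1').
    by exists [:: x] => z /= rz; exists 0%N.
have [g gq] : {g : Q -> H & forall y, q (g y) = y} by exact: (choice q_surj).
(* Past [n] the default [one] still yields a chart, so the fields hold at every index. *)
pose n := size ys; pose y i := nth one ys i.
pose rr i x := r (x ∙ inv (y i)).
have chi i := chart_transR (gq (y i)) ch.
pose rt x := \sum_(i < n) rr i x.
have rt0 x : 0 < rt x.
  have [l Ll Clx] := Ccov x; have [i isz ri] := ysP _ Clx.
  rewrite /rt (bigD1 (Ordinal isz))//= ltr_wpDr//.
    by apply: sumr_ge0 => j _; exact: (chart_ge0 (chi j)).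
  by rewrite /rr -(chart_inv (chi i) x Ll).
have crt : continuous rt.
  by move=> x; apply: cvg_sum_seq => i; exact: (chart_cts (chi i)).
exists n, (fun i x => dom (x ∙ inv (y i))), (fun x k => (\sum_(i < k) rr i x) / rt x),
  (fun i x => s (x ∙ inv (y i)) ⋆ g (y i)).
split.
- move=> x; split; first by rewrite big_ord0 mul0r.
  + by rewrite -/(rt x) divff// gt_eqF.
  + move=> k; rewrite ler_pM2r ?invr_gt0// big_ord_recr /= lerDl.
    exact: (chart_ge0 (chi k)).
- move=> k x; apply: cvgM; last by apply: cvgV; [rewrite gt_eqF|exact: crt].
  by apply: cvg_sum_seq => i; exact: (chart_cts (chi i)).
- move=> l x Ll; apply/funext => k; congr (_ / _).
    by apply: eq_bigr => i _; exact: (chart_inv (chi i)).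
  by apply: eq_bigr => i _; exact: (chart_inv (chi i)).
- move=> i x /(chart_out (chi i)); apply: filterS => z rz.
  by rewrite big_ord_recr /= /rr rz addr0.
- by move=> i x; exact: (chart_dom (chi i)).
- by move=> i x; exact: (chart_section_cts (chi i)).
- by move=> i x; exact: (chart_section (chi i)).
- by move=> i l x; exact: (chart_equiv (chi i)).
Qed.

End Atlas.

(** * The averaged quasimorphism *)

Section Extension.
Variables (R : realType).
Variables (H : topologicalType) (mulH : H -> H -> H) (invH : H -> H) (oneH : H).
Variables (Q : topologicalType) (mul : Q -> Q -> Q) (inv : Q -> Q) (one : Q).
Variables (G : set H) (q : H -> Q) (Lam : set Q) (s1 : Q -> H).
Hypothesis tgH : topological_group mulH invH oneH.
Hypothesis tgQ : topological_group mul inv one.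
Hypothesis q_cts : continuous q.
Hypothesis qM : group_hom mulH mul [set: H] q.
Hypothesis kerq : forall g, G g <-> q g = one.
Variables (n : nat) (dom : nat -> set Q) (a : Q -> nat -> R) (s : nat -> Q -> H).
Hypothesis atl : atlas mulH mul q Lam s1 n dom a s.
Variables (phi : H -> R) (D D' : R).
Hypothesis phi_cts : {within G, continuous phi}.
Hypothesis phi_qm : forall x y, G x -> G y -> `|phi (mulH x y) - phi x - phi y| <= D.
Hypothesis phi_qi : forall g x, G x ->
  `|phi (mulH (mulH g x) (invH g)) - phi x| <= D'.
Local Notation "x ∙ y" := (mul x y) (at level 40, left associativity).
Local Notation "x ⋆ y" := (mulH x y) (at level 40, left associativity).

(* [averand b g] is the average over [t] in [0, 1] of [phi (k_b(g))] for the
   section picked by [t]; [transition i j b g] is [k_b(g)] when [t] picks the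
   chart [i] at [b] and the chart [j] at [b q(g)]. *)
Definition transition i j (b : Q) (g : H) := g ⋆ invH (s j (b ∙ q g)) ⋆ s i b.

Definition averand (b : Q) (g : H) : R :=
  \sum_(i < n) \sum_(j < n)
    overlap2 (a b) (a (b ∙ q g)) i j * phi (transition i j b g).

Lemma step_dom x i : a x i < a x i.+1 -> dom i x.
Proof.
move=> ai; apply: contrapT => /(atlas_out atl) /nbhs_singleton ae.
by rewrite ae ltxx in ai.
Qed.

Lemma transition_ker i j b g : dom i b -> dom j (b ∙ q g) -> G (transition i j b g).
Proof.
move=> di dj; apply/kerq; rewrite /transition !(hom_mul qM) (hom_inv tgH tgQ qM).
by rewrite (atlas_section atl dj) (atlas_section atl di) !(tgE tgQ).
Qed.

Lemma near_fst (X Y : topologicalType) (x : X) (y : Y) (P : set X) :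
  nbhs x P -> \forall z \near (x, y), P z.1.
Proof.
by move=> Px; exists (P, setT) => /=; [split=> //; exact: filterT|move=> z []].
Qed.

(** A summand with [b0] or [b0 ∙ q g0] outside its domain vanishes nearby by [atlas_out]; in the
    others the sections are continuous. *)
Lemma averand_cvg b0 g0 :
  averand z.1 z.2 @[z --> (b0, g0)] --> averand b0 g0.
Proof.
have cq : q z.2 @[z --> (b0, g0)] --> q g0.
  by apply: (@continuous_cvg _ _ _ _ _ _ q); [exact: q_cts|exact: cvg_snd].
have cbq : z.1 ∙ q z.2 @[z --> (b0, g0)] --> b0 ∙ q g0.
  by apply: (tg_cvgM tgQ) => //; exact: cvg_fst.
apply: cvg_sum_seq => i; apply: cvg_sum_seq => j.
have [di|ndi] := pselect (dom i b0); last first.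
  have w0 : \forall z \near (b0, g0),
      overlap2 (a z.1) (a (z.1 ∙ q z.2)) i j * phi (transition i j z.1 z.2) = 0.
    have h : \forall z \near (b0, g0), a z.1 i = a z.1 i.+1.
      exact: (near_fst _ (atlas_out atl ndi)).
    apply: filterS h => z az; apply/eqP; rewrite mulf_eq0.
    apply: contra_eqT (az); rewrite negb_or => /andP[/overlap2_neq0[ai _] _].
    by rewrite lt_eqF.
  rewrite (_ : overlap2 (a b0) _ i j * _ = 0); last exact: (nbhs_singleton w0).
  exact: cvg_near_cst.
have [dj|ndj] := pselect (dom j (b0 ∙ q g0)); last first.
  have w0 : \forall z \near (b0, g0),
      overlap2 (a z.1) (a (z.1 ∙ q z.2)) i j * phi (transition i j z.1 z.2) = 0.
    have h : \forall z \near (b0, g0), a (z.1 ∙ q z.2) j = a (z.1 ∙ q z.2) j.+1.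
      exact: (cbq _ (atlas_out atl ndj)).
    apply: filterS h => z az; apply/eqP; rewrite mulf_eq0.
    apply: contra_eqT (az); rewrite negb_or => /andP[/overlap2_neq0[_ ai] _].
    by rewrite lt_eqF.
  rewrite (_ : overlap2 (a b0) _ i j * _ = 0); last exact: (nbhs_singleton w0).
  exact: cvg_near_cst.
apply: cvgM.
  apply: overlap2_cvg => k.
    apply: (@continuous_cvg _ _ _ _ _ _ (a ^~ k)); first exact: (atlas_cts atl).
    exact: cvg_fst.
  by apply: (@continuous_cvg _ _ _ _ _ _ (a ^~ k)) => //; exact: (atlas_cts atl).
have ct : transition i j z.1 z.2 @[z --> (b0, g0)] --> transition i j b0 g0.
  apply: (tg_cvgM tgH).
    apply: (tg_cvgM tgH); first exact: cvg_snd.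
    apply: (tg_cvgV tgH); apply: (@continuous_cvg _ _ _ _ _ _ (s j)) => //.
    exact: (atlas_section_cts atl).
  apply: (@continuous_cvg _ _ _ _ _ _ (s i)); last exact: cvg_fst.
  exact: (atlas_section_cts atl).
(* As [phi] is continuous only along [G], nearby transitions must be shown to lie in [G]. *)
have nG : \forall z \near (b0, g0), G (transition i j z.1 z.2).
  have h1 : \forall z \near (b0, g0), dom i z.1.
    exact: (near_fst _ (atlas_dom atl di)).
  have h2 : \forall z \near (b0, g0), dom j (z.1 ∙ q z.2).
    exact: (cbq _ (atlas_dom atl dj)).
  by apply: filterS2 h1 h2 => z; exact: transition_ker.
have /subspace_continuousP cphi := phi_cts.
have Gt : G (transition i j b0 g0) by exact: transition_ker.
move=> A /(cphi _ Gt) pA; have := ct _ pA.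
by apply: filterS2 nG => z Gz; apply.
Qed.

(** Equivariance gives both sections the same left factor [s1 l], which cancels in [transition]. *)
Lemma averand_lam l b g : Lam l -> averand (l ∙ b) g = averand b g.
Proof.
move=> Ll; apply: eq_bigr => i _; apply: eq_bigr => j _.
have aL x : a (l ∙ x) = a x by exact: (atlas_inv atl).
rewrite (tg_mulA tgQ) !aL.
have [->|/overlap2_neq0[/step_dom di /step_dom dj]] :=
  eqVneq (overlap2 (a b) (a (b ∙ q g)) i j) 0; first by rewrite !mul0r.
congr (_ * phi _); rewrite /transition (tg_mulA tgQ).
by rewrite (atlas_equiv atl Ll di) (atlas_equiv atl Ll dj) !(tgE tgH).
Qed.

(** Here [b ∙ q g = b], so only diagonal terms survive, and there [transition] is [g]. *)
Lemma averand_ker b g : G g -> averand b g = phi g.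
Proof.
move=> /kerq qg; rewrite /averand qg (tg_mulx1 tgQ).
have [a0 a1 aS] := atlas_cuts atl b.
rewrite -[RHS]mul1r -(sum_cuts (atlas_cuts atl b)) mulr_suml.
apply: eq_bigr => i _; rewrite (bigD1 i)//= big1 ?addr0 => [|j ji].
  rewrite overlap2_diag// eqxx; congr (_ * phi _).
  by rewrite /transition qg (tg_mulx1 tgQ) !(tgE tgH).
rewrite overlap2_diag// (_ : (i == j :> nat) = false) ?mul0r//.
by apply: contra_neqF ji => /eqP ij; exact/esym/val_inj.
Qed.

Lemma averand_quasi b g h :
  `|averand b (g ⋆ h) - averand b g - averand (b ∙ q g) h| <= D + D'.
Proof.
have bq : b ∙ q (g ⋆ h) = b ∙ q g ∙ q h by rewrite (hom_mul qM) (tg_mulA tgQ).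
have /= := @coupling_bound R n (a b) (a (b ∙ q g)) (a (b ∙ q g ∙ q h))
  (fun i k => phi (transition i k b (g ⋆ h))) (fun i j => phi (transition i j b g))
  (fun j k => phi (transition j k (b ∙ q g) h)) (D + D')
  (atlas_cuts atl _) (atlas_cuts atl _) (atlas_cuts atl _).
rewrite /averand bq; apply => i j k /step_dom di /step_dom dj /step_dom dk.
set A := transition i j b g; set B := transition j k (b ∙ q g) h.
have GA : G A by exact: transition_ker.
have GB : G B by exact: transition_ker.
(* The transition of [g ⋆ h] is [A] times the conjugate of [B] by [c]: splitting the product costs
   [D], undoing the conjugation [D']. *)
pose c := invH (s i b) ⋆ s j (b ∙ q g).
have -> : transition i k b (g ⋆ h) = A ⋆ (c ⋆ B ⋆ invH c).
  by rewrite /A /B /c /transition bq !(tgE tgH).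
have GcB : G (c ⋆ B ⋆ invH c).
  apply/kerq; move/kerq: GB => qB.
  rewrite (hom_mul qM (c ⋆ B)) (hom_mul qM c) qB (hom_inv tgH tgQ qM).
  by rewrite (tg_mulx1 tgQ) (tg_mulxV tgQ).
have := phi_qm GA GcB; have := phi_qi c GB.
set u := phi (c ⋆ B ⋆ invH c); move=> h1 h2.
rewrite (_ : _ - phi B = (phi (A ⋆ (c ⋆ B ⋆ invH c)) - phi A - u) + (u - phi B)); last by ring.
by apply: le_trans (ler_normD _ _) _; exact: lerD.
Qed.

(** * Averaging over the quotient *)

Variables (C : set Q) (J : (Q -> R) -> R).
Hypothesis cC : compact C.
Hypothesis Ccov : forall x, exists2 l, Lam l & C (l ∙ x).
Hypothesis JD : forall f g : Q -> R, lam_inv mul Lam f -> lam_inv mul Lam g ->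
  J (fun x => f x + g x) = J f + J g.
Hypothesis JZ : forall c (f : Q -> R), lam_inv mul Lam f -> J (fun x => c * f x) = c * J f.
Hypothesis Jp : forall f : Q -> R, lam_inv mul Lam f -> (forall x, 0 <= f x) -> 0 <= J f.
Hypothesis J1 : J (fun=> 1) = 1.
Hypothesis JR : forall (f : Q -> R) y, lam_inv mul Lam f -> J (fun x => f (x ∙ y)) = J f.

Lemma lam_inv_sub (f g : Q -> R) : lam_inv mul Lam f -> lam_inv mul Lam g ->
  lam_inv mul Lam (fun x => f x - g x).
Proof.
move=> [cf fL] [cg gL]; split; first by move=> x; apply: cvgB; [exact: cf|exact: cg].
by move=> l x Ll; rewrite fL// gL.
Qed.

Lemma mean_sub f g : lam_inv mul Lam f -> lam_inv mul Lam g ->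
  J (fun x => f x - g x) = J f - J g.
Proof.
move=> If Ig; have := JD (lam_inv_sub If Ig) Ig.
by under eq_fun do rewrite subrK; move=> ->; rewrite addrK.
Qed.

Lemma lam_inv_cst c : lam_inv mul Lam (fun=> c : R).
Proof. by split=> //; exact: cst_continuous. Qed.

Lemma mean_cst c : J (fun=> c) = c.
Proof.
rewrite -[RHS]mulr1 -J1 -JZ; last exact: lam_inv_cst.
by congr J; apply/funext => x; rewrite mulr1.
Qed.

Lemma mean_bound (f : Q -> R) c : lam_inv mul Lam f -> (forall x, `|f x| <= c) -> `|J f| <= c.
Proof.
move=> If fc; rewrite ler_norml; apply/andP; split.
  rewrite -subr_ge0 -(mean_cst (- c)) -mean_sub//; last exact: lam_inv_cst.
  apply: Jp; first exact: lam_inv_sub (lam_inv_cst _).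
  by move=> x; have := fc x; rewrite ler_norml subr_ge0 => /andP[].
rewrite -subr_ge0 -{1}(mean_cst c) -mean_sub//; last exact: lam_inv_cst.
apply: Jp; first exact: lam_inv_sub (lam_inv_cst _) _.
by move=> x; have := fc x; rewrite ler_norml subr_ge0 => /andP[].
Qed.

Lemma averand_inv g : lam_inv mul Lam (averand ^~ g).
Proof.
split=> [b|l b Ll]; last exact: averand_lam.
have cb : (y, g) @[y --> b] --> (b, g).
  by apply: cvg_pair; [exact: cvg_id|exact: cvg_cst].
exact: (cvg_comp _ (fun z => averand z.1 z.2) cb (averand_cvg (b0 := b) (g0 := g))).
Qed.

(** Joint continuity is uniform over the compact [C]; invariance extends the estimate to [Q], and
    the mean preserves it. *)
Lemma mean_averand_cts : continuous (fun g => J (averand ^~ g)).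
Proof.
move=> g0; apply/cvgrPdist_le => e e0.
have nC : \forall g \near g0, C `<=` [set b | `|averand b g0 - averand b g| <= e].
  apply: ((iffLR (compact_near_coveringP C)) cC H (nbhs g0)
    (fun g b => `|averand b g0 - averand b g| <= e)) => b _.
  have e2 : 0 < e / 2 by rewrite divr_gt0.
  have /cvgrPdist_lt/(_ _ e2) h1 := averand_cvg (b0 := b) (g0 := g0).
  have h2 : \forall z \near (b, g0), `|averand b g0 - averand z.1 g0| < e / 2.
    have : \forall y \near b, `|averand b g0 - averand y g0| < e / 2.
      have [ci _] := averand_inv g0.
      by have /cvgrPdist_lt := ci b; apply.
    exact: near_fst.
  apply: filterS2 h1 h2 => -[b' g] /= h1 h2.
  rewrite (_ : _ - _ = (averand b g0 - averand b' g) - (averand b g0 - averand b' g0)); last by ring.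
  by apply: le_trans (ler_normB _ _) _; lra.
apply: filterS nC => g Cg; rewrite -mean_sub; [|exact: averand_inv|exact: averand_inv].
apply: mean_bound; first by apply: lam_inv_sub; exact: averand_inv.
move=> x; have [l Ll Clx] := Ccov x.
by rewrite -(averand_lam x g Ll) -(averand_lam x g0 Ll); exact: Cg.
Qed.

Lemma mean_averand_ker g : G g -> J (averand ^~ g) = phi g.
Proof.
move=> Gg; rewrite -[RHS]mean_cst; congr J; apply/funext => b.
exact: averand_ker.
Qed.

(** Right invariance replaces the base point [b] in the [h] term by [b ∙ q g], the form that
    [averand_quasi] controls. *)
Lemma mean_averand_quasi g h :
  `|J (averand ^~ (g ⋆ h)) - J (averand ^~ g) - J (averand ^~ h)| <= D + D'.
Proof.
rewrite -(JR (q g) (averand_inv h)).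
have ci : lam_inv mul Lam (fun b => averand (b ∙ q g) h).
  have [cF FL] := averand_inv h; split.
    move=> b; apply: (@continuous_comp _ _ _ (fun b => b ∙ q g) (averand ^~ h) b).
      exact: (tg_continuousR tgQ).
    exact: cF.
  by move=> l b Ll; rewrite (tg_mulA tgQ) FL.
have ci2 : lam_inv mul Lam (fun b => averand b (g ⋆ h) - averand b g).
  by apply: lam_inv_sub; exact: averand_inv.
rewrite -(mean_sub (averand_inv (g ⋆ h)) (averand_inv g)) -(mean_sub ci2 ci).
by apply: mean_bound; [exact: lam_inv_sub|move=> b; exact: averand_quasi].
Qed.

End Extension.

(** * Defects and the extension theorem *)

Lemma defect_bound (R : realType) (T : Type) (mul : T -> T -> T) (S : set T)
    (f : T -> R) : quasimorphism_on mul S f ->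
  forall x y, S x -> S y -> `|f (mul x y) - f x - f y| <= defect mul S f.
Proof.
move=> [D HD] x y Sx Sy; apply: ub_le_sup; last by exists x => //; exists y.
by exists D => _ [x' Sx' [y' Sy' <-]]; exact: HD.
Qed.

Lemma qi_defect_bound (R : realType) (T : Type) (mul : T -> T -> T)
    (inv : T -> T) (S : set T) (f : T -> R) : quasi_invariant mul inv S f ->
  forall g x, S x -> `|f (mul (mul g x) (inv g)) - f x| <= qi_defect mul inv S f.
Proof.
move=> [D HD] g x Sx; apply: ub_le_sup; last by exists g => //; exists x.
by exists D => _ [g' _ [x' Sx' <-]]; exact: HD.
Qed.

Theorem theorem6p5 (R : realType)
  (Gh : topologicalType) (mulG : Gh -> Gh -> Gh) (invG : Gh -> Gh) (oneG : Gh)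
  (G : set Gh)
  (Q : topologicalType) (mulQ : Q -> Q -> Q) (invQ : Q -> Q) (oneQ : Q)
  (q : Gh -> Q)
  (Lam : set Q) (s1 : Q -> Gh)
  (B : set Q) (p : nat) (Bi : nat -> set Q) (s2 : nat -> Q -> Gh)
  (phi : Gh -> R) :
  (* Ghat Hausdorff topological group, G a subgroup (with subspace topology) *)
  topological_group mulG invG oneG -> hausdorff_space Gh ->
  subgroup mulG invG oneG G ->
  (* Q locally compact Hausdorff topological group *)
  topological_group mulQ invQ oneQ -> hausdorff_space Q ->
  locally_compact [set: Q] ->
  (* exact sequence 1 -> G -> Ghat -q-> Q -> 1 *)
  continuous q -> group_hom mulG mulQ [set: Gh] q ->
  (forall y : Q, exists g : Gh, q g = y) ->
  (forall g : Gh, G g <-> q g = oneQ) ->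
  (* Lambda discrete subgroup with a homomorphic section s1 *)
  subgroup mulQ invQ oneQ Lam -> discrete_subset Lam ->
  group_hom mulQ mulG Lam s1 ->
  (forall l, Lam l -> q (s1 l) = l) ->
  (* B relatively compact strict fundamental domain for left mult. by Lambda *)
  compact (closure B) ->
  (forall x : Q, exists b, [/\ B b, exists2 l, Lam l & b = mulQ l x &
     forall b', B b' -> (exists2 l, Lam l & b' = mulQ l x) -> b' = b]) ->
  (* finite Borel partition with continuous local sections on closures *)
  B = \bigcup_(i in [set i | (i < p)%N]) Bi i ->
  (forall i j, (i < p)%N -> (j < p)%N -> i <> j -> Bi i `&` Bi j = set0) ->
  (forall i, (i < p)%N -> borel_set (Bi i)) ->
  (forall i, (i < p)%N -> {within closure (Bi i), continuous (s2 i)}) ->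
  (forall i, (i < p)%N -> forall x, closure (Bi i) x -> q (s2 i x) = x) ->
  (* phi : G -> R a continuous Ghat-quasi-invariant quasimorphism *)
  {within G, continuous phi} ->
  quasimorphism_on mulG G phi ->
  quasi_invariant mulG invG G phi ->
  exists phih : Gh -> R,
    [/\ continuous phih,
        quasimorphism_on mulG [set: Gh] phih,
        (forall x, G x -> phih x = phi x) &
        defect mulG [set: Gh] phih <=
          defect mulG G phi + 3 * qi_defect mulG invG G phi].
Proof.
move=> tgG hG sgG tgQ hQ lcQ cq hq sq kerq sgL dsL hs1 s1K cB fundB BE _ _ s2c s2K.
move=> cphi qmphi qiphi.
have Ccov x : exists2 l, Lam l & closure B (mulQ l x).
  have [b [Bb [l Ll bE] _]] := fundB x.
  by exists l => //; rewrite -bE; exact: subset_closure.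
have BiC x : closure B x -> exists2 i, (i < p)%N & closure (Bi i) x.
  (* A finite union of closed sets is closed, so the closures of the pieces cover the closure of
     [B]. *)
  have clU : closed (\bigcup_(i in `I_p) closure (Bi i)).
    by apply: closed_bigcup => // i _; exact: closed_closure.
  move=> Bx; have [i ip Bix] : (\bigcup_(i in `I_p) closure (Bi i)) x.
    rewrite ((closure_id _).1 clU); apply: closureS Bx.
    by rewrite BE; apply: subset_bigcup => i _; exact: subset_closure.
  by exists i.
have [W W1 [sigma Wsigma]] := local_section_exists tgG tgQ lcQ hq sq sgL dsL
  cB Ccov BiC (fun i => @closed_closure _ (Bi i)) s2c s2K.
have [dom0 [r [s0 [ch r1]]]] := chart_exists R tgG tgQ hQ lcQ hq sgL dsL hs1 s1K W1 Wsigma.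
have [n [dom [a [s atl]]]] := atlas_exists tgG tgQ hq sq cB Ccov ch r1.
have [J [JD JZ Jp J1 JR]] := invariant_mean R tgQ lcQ hQ sgL dsL
  (ex_intro2 _ _ _ cB Ccov).
have Dphi := defect_bound qmphi; have D'phi := qi_defect_bound qiphi.
have quasi := mean_averand_quasi tgG tgQ cq hq kerq atl cphi Dphi D'phi JD JZ Jp J1 JR.
exists (fun g => J (averand mulG invG mulQ q n a s phi ^~ g)); split.
- exact: (mean_averand_cts tgG tgQ cq hq kerq atl cphi cB Ccov JD JZ Jp J1).
- by eexists => g h _ _; exact: quasi.
- by move=> g Gg; exact: (mean_averand_ker tgG tgQ kerq atl phi JZ J1 Gg).
have [G1 _] := sgG.
have D'0 : 0 <= qi_defect mulG invG G phi.
  by apply: le_trans (D'phi oneG oneG G1); exact: normr_ge0.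
(* The construction yields the constant 1 in front of the invariance defect; the latter being
   nonnegative, the constant 3 follows. *)
apply: (@le_trans _ _ (defect mulG G phi + qi_defect mulG invG G phi)); last by lra.
apply: ge_sup; first by exists (`|J (averand mulG invG mulQ q n a s phi ^~ (mulG oneG oneG)) - J (averand mulG invG mulQ q n a s phi ^~ oneG) - J (averand mulG invG mulQ q n a s phi ^~ oneG)|), oneG => //; exists oneG.
by move=> _ [g _ [h _ <-]]; exact: quasi.
Qed.
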